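(* 1) Let $t\ge0$. The cumulative distribution function of $Z_1(t)$ is given by $$\mathbb P(Z_1(t)\le x)=\sum_{k=-\infty}^\infty\left[F_X((2k+2)\pi-\arccos x,t)-F_X(\arccos x+2k\pi,t)\right],\qquad |x|\le1.$$ Furthermore, $$\mathbb P(Z_1(t)\in dx)=e^{-\lambda t}\,\delta_{\cos ct}(dx)+\nu(x,t)\,\mathbf 1_{|x|<1}\,dx,$$ where $\nu(x,t)\mathbf 1_{|x|<1}$ represents the density function of the absolutely continuous part of the law of $Z_1(t)$ and reads $$\nu(x,t)=\frac1{\sqrt{1-x^2}}\sum_{k=-\infty}^\infty\left[\mu((2k+2)\pi-\arccos x,t)\,\mathbf 1_{|(2k+2)\pi-\arccos x|<ct}+\mu(\arccos x+2k\pi,t)\,\mathbf 1_{|\arccos x+2k\pi|<ct}\right].$$ 2) Let $t\ge0$. The cumulative distribution function of $Z_2(t)$ is $$\mathbb P(Z_2(t)\le x)=\sum_{k=-\infty}^\infty\Big[F_X(\arcsin x+2k\pi,t)-F_X((2k-\tfrac12)\pi,t)+F_X((2k+\tfrac32)\pi,t)-F_X((2k+1)\pi-\arcsin x,t)\Big],\qquad |x|\le1.$$ Furthermore, $$\mathbb P(Z_2(t)\in dx)=\tfrac12e^{-\lambda t}\left[\delta_{\sin ct}(dx)+\delta_{-\sin ct}(dx)\right]+\eta(x,t)\,\mathbf 1_{|x|<1}\,dx,$$ where $\eta(x,t)\mathbf 1_{|x|<1}$ is the density function of the absolutely continuous part of the law of $Z_2(t)$, that is, $$\eta(x,t)=\frac1{\sqrt{1-x^2}}\sum_{k=-\infty}^\infty\left[\mu(\arcsin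 x+2k\pi,t)\,\mathbf 1_{|\arcsin x+2k\pi|<ct}+\mu((2k+1)\pi-\arcsin x,t)\,\mathbf 1_{|(2k+1)\pi-\arcsin x|<ct}\right].$$
   Context: Fix $\lambda,c>0$. $\{N(t),t\ge0\}$ is a homogeneous Poisson process of rate $\lambda$, $V(0)$ is independent of $N$ and uniform on $\{-c,c\}$, $V(t)=V(0)(-1)^{N(t)}$, and $X(t)=\int_0^tV(s)\,ds$ is the telegraph process. $Z_1(t):=\cos X(t)$ and $Z_2(t):=\sin X(t)$ (random harmonic oscillators). $\delta_a$ is the Dirac measure at $a$. The law of $X(t)$ is $p(dx,t)=\frac12e^{-\lambda t}[\delta_{-ct}(dx)+\delta_{ct}(dx)]+\mu(x,t)\mathbf 1_{|x|<ct}\,dx$, where $$\mu(x,t)=\frac{\lambda e^{-\lambda t}}2\left[\frac1cI_0\!\left(\frac\lambda c\sqrt{c^2t^2-x^2}\right)+t\,\frac{I_1\!\left(\frac\lambda c\sqrt{c^2t^2-x^2}\right)}{\sqrt{c^2t^2-x^2}}\right],\qquad |x|<ct,$$ and $I_\nu(y)=\sum_{k\ge0}\frac{(y/2)^{\nu+2k}}{k!\,\Gamma(k+\nu+1)}$ is the modified Bessel function. $F_X(x,t):=\int_{-\infty}^xp(dy,t)$ is the cumulative distribution function of $X(t)$. Terms whose indicator vanishes are read as $0$.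
   Formalization: The cdf formulas fail where an atom ±ct is a subtracted left endpoint: for Z_1 at x=cos ct<1, for Z_2 at x=±sin ct<1 with cos ct≤0. These x are excluded, and a corrected formula using the left limit F_X(·-,t) in the affected subtracted term is given for all -1≤x<1. *)

(* Defs.v *)
From HB Require Import structures.
From mathcomp Require Export all_boot all_order all_algebra.
From mathcomp Require Export all_classical all_reals all_analysis measurable_realfun.

Set Implicit Arguments.
Unset Strict Implicit.
Unset Printing Implicit Defensive.

Export Order.TTheory GRing.Theory Num.Theory.
Export numFieldNormedType.Exports.

#[global] Open Scope classical_set_scope.
#[global] Open Scope ring_scope.

Section Process.
Context (R : realType) (d : measure_display) (T : measurableType d).
Variable P : probability T R.

(* Some of the [B i] may be [setT], so the product rule over the whole index
   type contains the product rule over every subfamily. *)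
Definition mutually_independent (d' : measure_display) (U : measurableType d')
    (I : finType) (X : I -> T -> U) : Prop :=
  forall B : I -> set U, (forall i, measurable (B i)) ->
    P (\bigcap_(i in [set: I]) X i @^-1` B i)
    = (\prod_(i : I) P (X i @^-1` B i))%E.

(* Time is a real number; only the values at nonnegative times matter. The
   subtraction of [nat] is truncated, which is harmless since the paths are
   nondecreasing. Right-continuity of an integer-valued path means that it is
   locally constant on the right. *)
Record poisson_process (lam : R) (N : R -> T -> nat) : Prop := PoissonProcess {
  poisson_measurable : forall t, 0 <= t -> measurable_fun setT (N t) ;
  poisson_start : forall w, N 0 w = 0%N ;
  poisson_nondecreasing : forall w s t, 0 <= s -> s <= t ->
    (N s w <= N t w)%N ;
  poisson_right_continuous : forall w t, 0 <= t ->
    \forall s \near t^'+, N s w = N t w ;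
  poisson_increment : forall s t (k : nat), 0 <= s -> s < t ->
    P [set w | (N t w - N s w)%N = k] = (poisson_pmf (lam * (t - s)) k)%:E ;
  poisson_independent_increments : forall (n : nat) (s : nat -> R),
    0 <= s 0%N -> (forall i, (i < n)%N -> s i <= s i.+1) ->
    mutually_independent (fun (i : 'I_n) w => (N (s i.+1) w - N (s i) w)%N) }.

Definition process_sigma (N : R -> T -> nat) : set (set T) :=
  <<s \bigcup_(t in [set t : R | 0 <= t])
        preimage_set_system [set: T] (N t) measurable >>.

Definition independent_of_process (Y : T -> R) (N : R -> T -> nat) : Prop :=
  forall (B : set R) (A : set T), measurable B -> process_sigma N A ->
    P (Y @^-1` B `&` A) = (P (Y @^-1` B) * P A)%E.

Definition uniform_pm (Y : T -> R) (c : R) : Prop :=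
  P [set w | Y w = - c] = (2^-1)%:E /\ P [set w | Y w = c] = (2^-1)%:E.

Definition velocity (N : R -> T -> nat) (V0 : T -> R) (t : R) (w : T) : R :=
  V0 w * (-1) ^+ N t w.

Definition telegraph (N : R -> T -> nat) (V0 : T -> R) (t : R) (w : T) : R :=
  \int[lebesgue_measure]_(s in `[0, t]) velocity N V0 s w.

Definition Z1 (N : R -> T -> nat) (V0 : T -> R) (t : R) (w : T) : R :=
  cos (telegraph N V0 t w).

Definition Z2 (N : R -> T -> nat) (V0 : T -> R) (t : R) (w : T) : R :=
  sin (telegraph N V0 t w).

Definition law (Y : T -> R) (A : set R) : \bar R := P (Y @^-1` A).

End Process.

(* [f] is a density of the absolutely continuous part of the law [m] in its
   Lebesgue decomposition. *)
Definition ac_density (R : realType) (m : set R -> \bar R) (f : R -> \bar R)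
    : Prop :=
  [/\ measurable_fun [set: R] f, forall x, (0 <= f x)%E
    & exists s : {measure set R -> \bar R},
        (exists S : set R, [/\ measurable S, lebesgue_measure S = 0%E
                             & s (~` S) = 0%E])
        /\ forall A : set R, measurable A ->
             m A = (s A + \int[lebesgue_measure]_(x in A) f x)%E].

Section Formulas.
Context (R : realType).
Implicit Types (lam c x y t : R).

(* Integer order only, for which Gamma (k + n + 1) = (k + n)!. *)
Definition besselI (n : nat) y : R :=
  limn (series (fun k : nat =>
    (y / 2) ^+ (n + 2 * k) / (k`!%:R * (k + n)`!%:R))).

Definition mu lam c x t : R :=
  let r := Num.sqrt (c ^+ 2 * t ^+ 2 - x ^+ 2) in
  lam * expR (- (lam * t)) / 2 *
  (c^-1 * besselI 0 (lam / c * r) + t * (besselI 1 (lam / c * r) / r)).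

Definition mu_ind lam c x t : R := if `|x| < c * t then mu lam c x t else 0.

Definition telegraph_law lam c t (A : set R) : \bar R :=
  ((2^-1 * expR (- (lam * t)))%:E * (\d_(- (c * t))%R A + \d_(c * t)%R A)
   + \int[lebesgue_measure]_(x in A) (mu_ind lam c x t)%:E)%E.

Definition F_X lam c x t : R := fine (telegraph_law lam c t `]-oo, x]).

(* The left limit F_X(x-, t). *)
Definition F_X_left lam c x t : R := fine (telegraph_law lam c t `]-oo, x[).

(* Sum over all integers. [esum] is the supremum of the finite partial sums,
   hence the sum when the terms are nonnegative, as they are in every use below
   (F_X is nondecreasing and mu is nonnegative). *)
Definition zsum (u : int -> R) : \bar R := \esum_(k in [set: int]) (u k)%:E.

Definition nu lam c x t : \bar R :=
  (((Num.sqrt (1 - x ^+ 2))^-1)%:E *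
   zsum (fun k => (mu_ind lam c ((2 * k%:~R + 2) * pi - acos x) t
                + mu_ind lam c (acos x + 2 * k%:~R * pi) t)%R))%E.

Definition eta lam c x t : \bar R :=
  (((Num.sqrt (1 - x ^+ 2))^-1)%:E *
   zsum (fun k => (mu_ind lam c (asin x + 2 * k%:~R * pi) t
                + mu_ind lam c ((2 * k%:~R + 1) * pi - asin x) t)%R))%E.

(* [f] times the indicator of the open interval (-1, 1). *)
Definition on_unit (f : R -> \bar R) (x : R) : \bar R :=
  if `|x| < 1 then f x else 0%E.

End Formulas.

(* Main.v *)
From HB Require Import structures.
Require Import Defs.
From mathcomp Require Import ring lra zify.

(* Let W be the time spent by N in even values up to t, so that
   X(t) = V(0) (2 W - t). Split [0, t] into n steps of length h. Up to an event of
   probability O(1/n) the increments of N are 0 or 1, a given sequence with k ones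
   has probability exp(- lam t) (lam h)^k, and W is within k h of h times the number
   of steps that start with N even. The number of sequences with k ones and j such
   steps is a product of two binomial coefficients; times h^k, it is at most the
   integral of w^a (t - w)^b / (a! b!) over a cell of length h, where a = k/2 and
   b = (k-1)/2 rounded down.
   Letting n tend to infinity bounds the law of W on {N t = k} from above, and the
   total masses agree by the Beta integral. Summing over k gives the Bessel series
   of the law of X(t). Finally, cos and sin are inverted on each half period. *)

Set Implicit Arguments.
Unset Strict Implicit.
Unset Printing Implicit Defensive.

(** * Changes of variables in Lebesgue integrals *)

(** [poisson_process] gives probabilities only for increments between fixed times, so the law of W
    is reached by counting sequences of increments rather than by conditioning on jump times. An
    upper bound suffices because it comes without error term: C(i, m) h^m <= w^m / m! as soon as w
    >= i h. Half-lines are the right test sets: moving the end of one by e, to absorb the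
    discretization error of W, adds a single interval of length e, on which the density is bounded.
    The Bessel functions appear by pairing numbers of jumps: 2m+1 jumps produce the m-th term of
    I_0, and 2m+2 jumps the m-th term of the I_1 part. The absence of jumps produces the atoms. For
    the oscillators, the obstacle is the factor 1/sqrt(1 - y^2), unbounded near -1 and 1. The
    substitution is therefore proved for sin x dx, whose image under cos is Lebesgue measure on ]-1,
    1[, and the singular factor is put into the integrand, where it cancels sin x. *)

Section rays.
Context (R : realType).
Local Open Scope ereal_scope.

(** Open right rays are stable under intersection, generate the Borel sets and exhaust the line, so
    uniqueness of sigma-finite measures applies. *)
Lemma measure_eq_rays (m1 m2 : {measure set (measurableTypeR R) -> \bar R}) :
  (forall x : R, m1 `]x, +oo[%classic = m2 `]x, +oo[%classic) ->
  (forall x : R, m1 `]x, +oo[%classic < +oo) ->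
  forall A, measurable A -> m1 A = m2 A.
Proof.
move=> m12 m1oo A mA.
apply: (@measure_unique _ R (measurableTypeR R) (@RGenOInfty.G R) (fun n => `](- n%:R)%R, +oo[%classic)) => //.
- exact: RGenOInfty.measurableE.
- move=> _ _ [x ->] [y ->]; exists (Num.max x y).
  apply/seteqP; split => z /=; rewrite !in_itv/= !andbT gt_max.
    by case=> -> ->.
  by move/andP.
- by move=> n; exists (- n%:R)%R.
- apply/seteqP; split => // z _; exists (Num.truncn `|z|).+1 => //=.
  rewrite in_itv/= andbT ltrNl (le_lt_trans (ler_norm _))// normrN.
  by rewrite truncnS_gt.
- by move=> B [x ->].
Qed.

(** Lebesgue measure is [|a|] times its own image under x -> a x + b, since both give every interval
    []u, v]] its length. *)
Lemma integral_affine (a b : R) (f : R -> \bar R) (A : set R) : (a != 0)%R ->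
  measurable A -> measurable_fun [set: R] f -> (forall x, 0 <= f x) ->
  \int[lebesgue_measure]_(x in A) f x =
  `|a|%:E * \int[lebesgue_measure]_(x in (fun x => a * x + b)%R @^-1` A)
     f (a * x + b)%R.
Proof.
move=> a0 mA mf f0.
pose phi : measurableTypeR R -> measurableTypeR R := (fun x => a * x + b)%R.
have mphi : measurable_fun setT phi.
  by apply: measurable_funD => //; apply: measurable_funM.
pose an : {nonneg R} := NngNum (normr_ge0 a).
pose m : {measure set (measurableTypeR R) -> \bar R} :=
  mscale an (measure_function_pushforward__canonical__measure_function_Measure
    lebesgue_measure mphi).
have lphi B : measurable B ->
    lebesgue_measure B = m B.
  apply: lebesgue_measure_unique => _ [[u v] /= _ <-].
  rewrite /m /mscale/= /pushforward /phi.
  have [a_gt0|a_lt0|/eqP] := ltgtP 0%R a; last by rewrite eq_sym (negbTE a0).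
    rewrite (_ : _ @^-1` _ = `](u - b) / a, (v - b) / a]%classic)%R; last first.
      apply/seteqP; split => x /=; rewrite !in_itv/=;
        by rewrite ltr_pdivrMr// ler_pdivlMr// ltrBlDr lerBrDr (mulrC a).
    rewrite !lebesgue_measure_itv/= !lte_fin ltr_pM2r ?invr_gt0// ltrD2r.
    case: ifPn => _; last by rewrite mule0.
    rewrite -!EFinB -EFinM gtr0_norm//; congr (_%:E); field.
    by rewrite gt_eqF.
  (* A negative slope exchanges the ends and moves the closed end to the left; the length does not
     see this. *)
  rewrite (_ : _ @^-1` _ = `[(v - b) / a, (u - b) / a[%classic)%R; last first.
    apply/seteqP; split => x /=; rewrite !in_itv/=;
      by rewrite ltr_ndivlMr// ler_ndivrMr// ltrBlDr lerBrDr (mulrC a) andbC.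
  rewrite !lebesgue_measure_itv/= !lte_fin ltr_nM2r ?invr_lt0// ltrD2r.
  case: ifPn => _; last by rewrite mule0.
  rewrite -!EFinB -EFinM ltr0_norm//; congr (_%:E); field.
  by rewrite lt_eqF.
have mfA D : measurable_fun D f by exact: measurable_funTS.
rewrite (@eq_measure_integral _ _ _ _ m); last first.
  by move=> B mB _; exact: lphi.
rewrite -[in RHS](ge0_integral_pushforward mphi lebesgue_measure)//;
  last exact: mfA.
by apply: ge0_integral_mscale => //; exact: mfA.
Qed.

End rays.

(** * Measures given by a density *)

Section density_measure.
Context (R : realType) d (T : measurableType d).
Variables (m : {measure set T -> \bar R}) (w : T -> R).
Hypotheses (mw : measurable_fun [set: T] w) (w0 : forall x, (0 <= w x)%R).
Local Open Scope ereal_scope.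

(** The two proofs are arguments so that the term itself carries what the measure instance below
    requires. *)
Definition density_measure of measurable_fun [set: T] w & forall x, (0 <= w x)%R :=
  fun A : set T => \int[m]_(x in A) (w x)%:E.

Local Notation dm := (density_measure mw w0).

Let mwE D : measurable_fun D (EFin \o w).
Proof. by apply/measurable_EFinP; exact: measurable_funTS. Qed.

Let dm0 : dm set0 = 0. Proof. exact: integral_set0. Qed.

Let dm_ge0 A : 0 <= dm A.
Proof. by apply: integral_ge0 => x _; rewrite lee_fin. Qed.

Let dm_sigma_additive : semi_sigma_additive dm.
Proof.
move=> /= F mF tF mUF; rewrite /density_measure; apply: cvg_toP.
  apply: ereal_nondecreasing_is_cvgn => i j ij.
  apply: lee_sum_nneg_natr => // k _ _.
  by apply: integral_ge0 => x _; rewrite lee_fin.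
by rewrite ge0_integral_bigcup//= => x _; rewrite lee_fin.
Qed.

HB.instance Definition _ := isMeasure.Build _ _ _ dm
  dm0 dm_ge0 dm_sigma_additive.

Import HBNNSimple.

(** Monotone convergence on both sides reduces the identity to simple functions, and linearity to
    indicators, where it is the definition of [dm]. *)
Lemma ge0_integral_density (f : T -> \bar R) D : measurable D ->
  measurable_fun D f -> (forall x, 0 <= f x) ->
  \int[dm]_(x in D) f x = \int[m]_(x in D) (f x * (w x)%:E).
Proof.
move=> mD mf f0; pose f_ := nnsfun_approx mD mf.
have w0E x : 0 <= (w x)%:E by rewrite lee_fin.
transitivity (limn (fun n => \int[dm]_(x in D) (f_ n x)%:E)).
  rewrite -monotone_convergence//=.
  - apply: eq_integral => x /[!inE] xD; apply/esym/cvg_lim => //=.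
    exact: cvg_nnsfun_approx.
  - by move=> n; exact/measurable_EFinP/measurable_funTS.
  - by move=> n x _; rewrite lee_fin.
  - by move=> x _ i j ij; rewrite lee_fin; exact/lefP/nd_nnsfun_approx.
transitivity (limn (fun n => \int[m]_(x in D) ((f_ n x)%:E * (w x)%:E))).
  apply: congr_lim; apply/funext => n.
  under [LHS]eq_integral do rewrite fimfunE -fsumEFin//. 
  rewrite (@ge0_integral_fsum _ _ _ dm D mD _ (fun r x => (r * \1_(f_ n @^-1` [set r]) x)%:E))//; last 2 first.
  - by move=> r; exact/measurable_EFinP/measurableT_comp.
  - by move=> r x _; rewrite EFinM nnfun_muleindic_ge0.
  under [RHS]eq_integral.
    move=> x _; rewrite fimfunE -fsumEFin// ge0_mule_fsuml; last first.
      by move=> r; rewrite EFinM nnfun_muleindic_ge0.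
    over.
  rewrite [RHS]ge0_integral_fsum//; last 2 first.
  - move=> r; apply: emeasurable_funM => //.
    by apply/measurable_EFinP; do 2 apply/measurableT_comp => //.
  - by move=> r x _; rewrite mule_ge0// EFinM nnfun_muleindic_ge0.
  apply: eq_fsbigr => r _.
  rewrite integralZl_indic_nnsfun//= integral_indic//=.
  have [r_ge0|r_lt0] := leP 0%R r; last first.
    rewrite preimage_nnfun0// set0I measure0 mule0 integral0_eq// => x _.
    by rewrite indic0 mulr0 mul0e.
  under eq_integral do rewrite EFinM -muleA.
  rewrite ge0_integralZl//=; last 2 first.
    by apply: emeasurable_funM => //; exact/measurable_EFinP/measurable_indic.
    by move=> x _; rewrite mule_ge0// lee_fin.
  congr (_ * _); rewrite /density_measure setIC integral_mkcondr.
  by apply: eq_integral => x _; rewrite patchE indicE; case: ifPn => _;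
    rewrite ?mul1e ?mul0e.
rewrite -monotone_convergence//=.
- apply: eq_integral => x /[!inE] xD; apply/cvg_lim => //=.
  by apply: cvgeZr => //; exact: cvg_nnsfun_approx.
- move=> n; apply: emeasurable_funM => //.
  by apply/measurable_EFinP/measurable_funTS.
- by move=> n x _; rewrite mule_ge0// lee_fin.
- move=> x _ i j ij; apply: lee_wpmul2r => //; rewrite lee_fin.
  exact/lefP/nd_nnsfun_approx.
Qed.

End density_measure.

(** * Substitution y = cos x on a half period *)

Section cos_substitution.
Context (R : realType).
Local Notation lebesgue := (@lebesgue_measure R).
Implicit Types (x y : R) (h : R -> \bar R).

Lemma measurable_sin : measurable_fun [set: R] (@sin R).
Proof. by apply: continuous_measurable_fun; exact: continuous_sin. Qed.

Lemma measurable_cos : measurable_fun [set: R] (@cos R).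
Proof. by apply: continuous_measurable_fun; exact: continuous_cos. Qed.

Lemma integral_sin_from0 y : 0 <= y ->
  (\int[lebesgue]_(x in `]0%R, y[) (sin x)%:E = (1 - cos y)%:E)%E.
Proof.
rewrite le_eqVlt => /predU1P[<-|y0].
  by rewrite set_itvoo0 integral_set0 cos0 subrr.
rewrite -(@integral_itv_bndoo _ 0 y _ true false); last first.
  by apply/measurable_EFinP; apply: measurable_funTS; exact: measurable_sin.
rewrite (@continuous_FTC2 _ _ (fun x => - cos x))//.
- by rewrite cos0 -EFinB opprK addrC.
- exact/continuous_subspaceT/continuous_sin.
- split.
  + by move=> x _; apply: derivableN; exact: derivable_cos.
  + by apply: cvg_at_right_filter; apply: cvgN; exact: continuous_cos.
  + by apply: cvg_at_left_filter; apply: cvgN; exact: continuous_cos.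
- by move=> x _; rewrite derive1E deriveN ?derivable_cos// derive_val opprK.
Qed.

(** Cutting the sine off makes it a nonnegative density on the whole line. *)
Definition sin_half x : R := if x \in `]0, pi[ then sin x else 0.

Lemma sin_half_ge0 x : 0 <= sin_half x.
Proof.
rewrite /sin_half; case: ifPn => //.
by rewrite in_itv/= => ?; rewrite ltW// sin_gt0_pi.
Qed.

Lemma measurable_sin_half : measurable_fun [set: R] sin_half.
Proof.
apply: measurable_fun_if => //.
- by apply: measurable_fun_bool; rewrite setTI; exact: measurable_itv.
- by apply: measurable_funTS; exact: measurable_sin.
Qed.

(* Stated as the image of sin x dx rather than of dx, since the density of the
   latter is singular at -1 and 1. *)
Lemma ge0_integral_cos_substitution h : measurable_fun [set: R] h ->
  (forall x, (0 <= h x)%E) ->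
  (\int[lebesgue]_(x in `]0%R, pi[) (h (cos x) * (sin x)%:E) =
   \int[lebesgue]_(y in `](- 1)%R, 1%R[) h y)%E.
Proof.
move=> mh h0.
have mcos : measurable_fun [set: measurableTypeR R] (@cos R : _ -> measurableTypeR R).
  exact: measurable_cos.
have n11 : (-1 : R) < 1 by lra.
pose dm : {measure set (measurableTypeR R) -> \bar R} :=
  density_measure lebesgue measurable_sin_half sin_half_ge0.
pose m2 : {measure set (measurableTypeR R) -> \bar R} :=
  measure_function_pushforward__canonical__measure_function_Measure dm mcos.
have indic_ge0 x : 0 <= \1_`](- 1)%R, 1%R[%classic x :> R by rewrite indicE.
pose m1 : {measure set (measurableTypeR R) -> \bar R} :=
  density_measure lebesgue (measurable_indic (measurable_itv `](- 1)%R, 1%R[))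
    indic_ge0.
have m12 A : measurable A -> m1 A = m2 A.
  apply: measure_eq_rays => y; last first.
    rewrite /m1/= /density_measure integral_indic//.
    apply: (@le_lt_trans _ _ (lebesgue `](- 1)%R, 1%R[)).
      by apply: le_measure; rewrite ?inE//; exact: measurableI.
    by rewrite lebesgue_measure_itv/= lte_fin n11 -EFinB ltry.
  (* Clamping [y] to [-1, 1] brings it into the domain of [acos]; both measures of the ray above [y]
     are then 1 - z, the second as the integral of sin over []0, acos z[]. *)
  pose z := Num.min 1 (Num.max (- 1) y).
  have z11 : -1 <= z <= 1.
    by rewrite /z le_min ge_min le_max lexx; lra.
  have -> : m1 `]y, +oo[%classic = lebesgue `]z, 1[%classic.
    rewrite /m1/= /density_measure integral_indic//; congr (lebesgue _).
    apply/seteqP; split => x /=; rewrite !in_itv/= andbT /z gt_min gt_max.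
      by move=> [/andP[-> ->] ->]; rewrite orbT.
    by move=> /andP[/orP[x1 x1'|/andP[-> ->] ->//]]; lra.
  transitivity (\int[lebesgue]_(x in `]0%R, acos z[) (sin x)%:E)%E.
    rewrite integral_sin_from0; last by rewrite acos_ge0.
    rewrite acosK; last by rewrite in_itv.
    rewrite lebesgue_measure_itv/= lte_fin; case: ltP => // z1.
    by rewrite (_ : z = 1) ?subrr//; lra.
  rewrite /m2/= /pushforward /density_measure.
  rewrite [LHS]integral_mkcond [RHS]integral_mkcond.
  apply: eq_integral => x _; rewrite !patchE.
  rewrite /sin_half; have [x0pi|x0pi] := boolP (x \in `]0, pi[); last first.
    rewrite ifF; last first.
      apply/negbTE; apply: contra x0pi; rewrite inE/= !in_itv/=.
      by move=> /andP[->/= /lt_le_trans]; apply; rewrite acos_lepi.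
    by case: ifPn.
  have cx : -1 < cos x < 1.
    have := x0pi; rewrite in_itv/= => /andP[x0 xpi].
    rewrite -cospi -cos0 !ltr_cos ?x0 ?xpi// in_itv/= ?lexx ?pi_ge0//;
      by rewrite !ltW.
  have -> : (x \in `]0, (acos z)[%classic) = (x \in cos @^-1` `]y, +oo[%classic).
    move: x0pi; rewrite in_itv/= => /andP[x0 xpi].
    have -> : (x \in cos @^-1` `]y, +oo[%classic) = (y < cos x).
      by apply/idP/idP; rewrite inE/= in_itv/= andbT.
    have -> : (x \in `]0, (acos z)[%classic) = (x < acos z).
      by apply/idP/idP; rewrite inE/= in_itv/= x0.
    rewrite -[LHS]ltr_cos ?in_itv/= ?acos_ge0 ?acos_lepi ?(ltW x0) ?(ltW xpi)//.
    rewrite acosK ?in_itv// /z gt_min gt_max; move: cx => /andP[-> cx1].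
    by rewrite (ltNge 1) (ltW cx1).
  by [].
transitivity (\int[lebesgue]_x ((h \o cos) x * (sin_half x)%:E))%E.
  rewrite integral_mkcond; apply: eq_integral => x _; rewrite patchE /sin_half.
  by rewrite mem_setE; case: ifPn => //; rewrite mule0.
rewrite -(@ge0_integral_density _ _ (measurableTypeR R) lebesgue _
  measurable_sin_half sin_half_ge0)//=; last first.
  by apply: measurableT_comp => //; exact: measurable_cos.
transitivity (\int[m2]_x h x)%E.
  by rewrite (ge0_integral_pushforward mcos).
rewrite -(@eq_measure_integral _ _ _ _ m2 m1); last by move=> A mA _; exact: m12.
rewrite ge0_integral_density//.
rewrite [RHS]integral_mkcond; apply: eq_integral => x _; rewrite patchE indicE.
by case: ifPn; rewrite ?mule1 ?mule0.
Qed.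

End cos_substitution.

(** The enumeration 0, -1, 1, -2, 2, ... of the integers; it turns sums over [int] into series, to
    which the convergence theorems apply. *)
Definition int_of_nat_zigzag (n : nat) : int :=
  if odd n then Negz n./2 else Posz n./2.

Lemma int_of_nat_zigzag_bij : bijective int_of_nat_zigzag.
Proof.
exists (fun z => match z with Posz m => m.*2 | Negz m => m.*2.+1 end).
  by move=> n; rewrite /int_of_nat_zigzag; case: ifP => on; lia.
by case=> m; rewrite /int_of_nat_zigzag/= odd_double ?doubleK// uphalf_double.
Qed.

Lemma esum_int (R : realType) (a : int -> \bar R) : (forall k, (0 <= a k)%E) ->
  (\esum_(k in [set: int]) a k = \sum_(n <oo) a (int_of_nat_zigzag n))%E.
Proof.
move=> a0; rewrite nneseries_esumT//; apply: reindex_esum.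
by rewrite setTT_bijective; exact: int_of_nat_zigzag_bij.
Qed.

Lemma cos_add_period (R : realType) (k : int) (x : R) :
  cos (x + 2 * k%:~R * pi) = cos x.
Proof.
have cosn (n : nat) (y : R) : cos (y + 2 * n%:R * pi) = cos y.
  rewrite -[RHS](periodicn (@cosD2pi R) n) -mulrnA -[pi *+ _]mulr_natl natrM.
  by congr (cos (_ + _ * _)).
case: k => n; first exact: cosn.
by rewrite -(cosn n.+1) NegzE; congr cos; rewrite mulrNz; ring.
Qed.

(** * Integrals over preimages under the cosine *)

Section cos_preimage.
Context (R : realType).
Local Notation lebesgue := (@lebesgue_measure R).
Implicit Types (x y : R) (A : set R) (f : R -> \bar R).

Lemma measurable_cos_preimage A : measurable A -> measurable (cos @^-1` A).
Proof. by move=> mA; rewrite -[X in measurable X]setTI; exact: measurable_cos. Qed.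

Lemma measurable_acos : measurable_fun (`](-1)%R, 1%R[ : set R) (@acos R).
Proof.
apply: open_continuous_measurable_fun; first exact: interval_open.
by move=> x; rewrite inE/= in_itv/=; exact: continuous_acos.
Qed.

Lemma measurable_inv_sqrt : measurable_fun (`](-1)%R, 1%R[ : set R)
  (fun y => (Num.sqrt (1 - y ^+ 2))^-1).
Proof.
apply: open_continuous_measurable_fun; first exact: interval_open.
move=> x; rewrite inE/= in_itv/= => /andP[x_gtN1 x_lt1].
apply: cvgV.
  by rewrite gt_eqF// sqrtr_gt0 subr_gt0 -real_normK ?num_real// exprn_ilt1 ?ltr_norml ?x_gtN1.
apply: (@continuous_comp _ _ _ (fun y : R => 1 - y ^+ 2) Num.sqrt); last first.
  exact: sqrt_continuous.
by apply: cvgB; [exact: cvg_cst|exact: exprn_continuous].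
Qed.

Lemma measurable_arc_density f : measurable_fun [set: R] f ->
  measurable_fun (`](-1)%R, 1%R[ : set R)
    (fun y => ((Num.sqrt (1 - y ^+ 2))^-1)%:E * f (acos y))%E.
Proof.
move=> mf; apply: emeasurable_funM.
  by apply/measurable_EFinP; exact: measurable_inv_sqrt.
by apply: (@measurableT_comp _ _ _ _ _ _ f) => //; exact: measurable_acos.
Qed.

Lemma inv_sqrt_ge0 y : (0 <= ((Num.sqrt (1 - y ^+ 2))^-1)%:E)%E.
Proof. by rewrite lee_fin invr_ge0 sqrtr_ge0. Qed.

(** The substitution is applied to f(acos y) / sqrt(1 - y^2) cut off to A: at y = cos x the root is
    sin x, which cancels the weight sin x. *)
Lemma ge0_integral_cos_preimage_0pi A f : measurable A ->
  measurable_fun [set: R] f -> (forall x, (0 <= f x)%E) ->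
  (\int[lebesgue]_(x in `]0%R, pi[ `&` cos @^-1` A) f x =
   \int[lebesgue]_(y in `](- 1)%R, 1%R[ `&` A)
     (((Num.sqrt (1 - y ^+ 2))^-1)%:E * f (acos y)))%E.
Proof.
move=> mA mf f0.
pose h y := (((Num.sqrt (1 - y ^+ 2))^-1)%:E * f (acos y))%E.
pose D : set R := `](- 1)%R, 1%R[ `&` A.
have mD : measurable D by exact: measurableI.
transitivity (\int[lebesgue]_(y in `](- 1)%R, 1%R[) (h \_ D) y)%E; last first.
  rewrite [RHS]integral_mkcondr; apply: eq_integral => y y11.
  by rewrite !patchE in_setI y11.
rewrite -[RHS]ge0_integral_cos_substitution; last 2 first.
- apply/(measurable_restrictT h mD).
  apply: (@measurable_funS _ _ _ _ (`](- 1)%R, 1%R[ : set R)) => //.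
    by move=> y [].
  exact: measurable_arc_density.
- move=> x; rewrite patchE; case: ifPn => // _.
  by rewrite mule_ge0// inv_sqrt_ge0.
rewrite integral_mkcondr; apply: eq_integral => x; rewrite inE/= in_itv/=.
move=> /andP[x0 xpi]; rewrite !patchE.
have cx11 : `](- 1)%R, 1%R[%classic (cos x).
  rewrite /= in_itv/= -cospi -cos0 !ltr_cos ?x0 ?xpi// in_itv/= ?lexx ?pi_ge0//;
    by rewrite !ltW.
have -> : (cos x \in D) = (x \in cos @^-1` A).
  by apply/idP/idP; rewrite !inE; [case|].
case: ifPn => [xA|_]; last by rewrite mul0e.
have sx : 0 < sin x by rewrite sin_gt0_pi// x0.
rewrite /h cosK; last by rewrite in_itv/= !ltW.
rewrite -sin2cos2 sqrtr_sqr gtr0_norm// muleAC -EFinM mulVf ?gt_eqF//.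
by rewrite mul1e.
Qed.

Lemma integral_itv_setI_bndoo A f b0 b1 (u v : R) : measurable A ->
  measurable_fun [set: R] f ->
  (\int[lebesgue]_(x in [set` Interval (BSide b0 u) (BSide b1 v)] `&` A) f x =
   \int[lebesgue]_(x in `]u, v[ `&` A) f x)%E.
Proof.
move=> mA mf; rewrite integral_mkcondr [RHS]integral_mkcondr.
rewrite integral_itv_bndoo//; apply: measurable_funTS.
by apply/(measurable_restrictT f mA); exact: measurable_funTS.
Qed.

(** The reflection x -> 2 pi - x preserves the cosine and carries the second half period onto the
    first. *)
Lemma ge0_integral_cos_preimage_period A f : measurable A ->
  measurable_fun [set: R] f -> (forall x, (0 <= f x)%E) ->
  (\int[lebesgue]_(x in `[0%R, (2 * pi)%R[ `&` cos @^-1` A) f x =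
   \int[lebesgue]_(y in `](- 1)%R, 1%R[ `&` A)
     (((Num.sqrt (1 - y ^+ 2))^-1)%:E * (f (2 * pi - acos y)%R + f (acos y))))%E.
Proof.
move=> mA mf f0; have mC := measurable_cos_preimage mA.
have pi0 := pi_gt0 R.
have mr : measurable_fun [set: R] (fun x : R => f (2 * pi - x)%R).
  by apply: measurableT_comp => //; exact: measurable_funB.
rewrite -(@ge0_integral_cos_preimage_0pi _ (fun x => f (2 * pi - x)%R + f x)%E)//;
  last 2 first.
- exact: emeasurable_funD.
- by move=> x; rewrite adde_ge0.
rewrite ge0_integralD//; last 3 first.
- by apply: measurableI.
- exact: measurable_funTS.
- exact: measurable_funTS.
have -> : `[0%R, 2 * pi[%classic = `[0%R, pi[ `|` `[pi, 2 * pi[ :> set R.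
  apply/seteqP; split => x /=; rewrite !in_itv/=.
    by move=> /andP[-> ->]/=; rewrite andbT; case: (ltP x pi); [left|right].
  by move=> [] /andP[] *; apply/andP; split; lra.
rewrite setIUl ge0_integral_setU//; last 4 first.
- exact: measurableI.
- exact: measurableI.
- exact: measurable_funTS.
- apply/disj_setPS => x /= [[+ _] [+ _]]; rewrite !in_itv/=; lra.
rewrite addeC; congr (_ + _)%E.
  rewrite (@integral_affine _ (-1) (2 * pi))//; last exact: measurableI.
  rewrite normrN1 mul1e.
  rewrite -(@integral_itv_setI_bndoo _ _ false false)//.
  rewrite (_ : _ @^-1` _ = `]0%R, pi] `&` cos @^-1` A); last first.
    apply/seteqP; split => x /=; rewrite !in_itv/=.
      move=> [xpi cA]; split; first lra.
      move: cA; rewrite mulN1r addrC cosB.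
      by rewrite mulr_natl cos2pi sin2pi mul1r mul0r addr0.
    move=> [xpi cA]; split; first lra.
    rewrite mulN1r addrC cosB.
    by rewrite mulr_natl cos2pi sin2pi mul1r mul0r addr0.
  by apply: eq_integral => x _; rewrite mulN1r addrC.
exact: integral_itv_setI_bndoo.
Qed.

(** The line is cut into periods, each period is shifted to [0, 2 pi[, and the sum is exchanged with
    the integral because all terms are nonnegative. *)
Lemma ge0_integral_cos_preimage A f : measurable A ->
  measurable_fun [set: R] f -> (forall x, (0 <= f x)%E) ->
  (\int[lebesgue]_(x in cos @^-1` A) f x =
   \int[lebesgue]_(y in A) on_unit (fun y => ((Num.sqrt (1 - y ^+ 2))^-1)%:E *
     \esum_(k in [set: int])
       (f ((2 * k%:~R + 2) * pi - acos y)%R + f (acos y + 2 * k%:~R * pi)%R))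
     y)%E.
Proof.
move=> mA mf f0; have mC := measurable_cos_preimage mA.
have pi0 := pi_gt0 R.
have mfD (D : set R) : measurable_fun D f by exact: measurable_funTS.
pose e := int_of_nat_zigzag.
pose I (k : int) : set R := `[2 * k%:~R * pi, 2 * k%:~R * pi + 2 * pi[%classic.
(* Membership as a condition on a floor gives both that the periods cover the line and that they are
   disjoint. *)
have IE k x : I k x = (Num.floor (x / (2 * pi)) == k) :> Prop.
  rewrite /I /= in_itv/= floor_eq ler_pdivlMr ?mulr_gt0// ltr_pdivrMr ?mulr_gt0//.
  have -> : (k + 1)%:~R * (2 * pi) = 2 * k%:~R * pi + 2 * pi :> R by rewrite intrD; ring.
  by have -> : k%:~R * (2 * pi) = 2 * k%:~R * pi :> R by ring.
have CE : cos @^-1` A = \bigcup_n (I (e n) `&` cos @^-1` A).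
  rewrite -setI_bigcupl (_ : \bigcup_n I (e n) = setT) ?setTI//.
  apply/seteqP; split => // x _.
  have [g _ eK] := int_of_nat_zigzag_bij.
  by exists (g (Num.floor (x / (2 * pi)))) => //=; rewrite IE /e eK.
have mIC k : measurable (I k `&` cos @^-1` A).
  by apply: measurableI => //; exact: measurable_itv.
have mG (k : int) : measurable_fun (`](-1)%R, 1%R[ : set R) (fun y =>
    ((Num.sqrt (1 - y ^+ 2))^-1)%:E *
    (f ((2 * k%:~R + 2) * pi - acos y)%R + f (acos y + 2 * k%:~R * pi)%R))%E.
  apply: (@measurable_arc_density (fun x =>
     f ((2 * k%:~R + 2) * pi - x)%R + f (x + 2 * k%:~R * pi)%R)%E).
  apply: emeasurable_funD; apply: measurableT_comp => //.
    exact: measurable_funB.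
  exact: measurable_funD.
have mGA (k : int) : measurable_fun (`](-1)%R, 1%R[ `&` A : set R) (fun y =>
    ((Num.sqrt (1 - y ^+ 2))^-1)%:E *
    (f ((2 * k%:~R + 2) * pi - acos y)%R + f (acos y + 2 * k%:~R * pi)%R))%E.
  by apply: (measurable_funS _ _ (mG k)) => // y [].
rewrite {1}CE ge0_integral_bigcup//; last 3 first.
- by move=> n; exact: mIC.
- exact: mfD.
- apply/trivIsetP => i j _ _ ij; rewrite -subset0 => x [[+ _] [+ _]].
  rewrite !IE => /eqP -> /eqP eij; have := bij_inj int_of_nat_zigzag_bij eij.
  by apply/eqP.
transitivity (\sum_(n <oo) \int[lebesgue]_(y in `](-1)%R, 1%R[ `&` A)
    (((Num.sqrt (1 - y ^+ 2))^-1)%:E *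
    (f ((2 * (e n)%:~R + 2) * pi - acos y)%R
     + f (acos y + 2 * (e n)%:~R * pi)%R)))%E.
  apply: eq_eseriesr => n _.
  rewrite (@integral_affine _ 1 (2 * (e n)%:~R * pi) f (I (e n) `&` cos @^-1` A))//.
  rewrite normr1 mul1e.
  rewrite (_ : _ @^-1` _ = `[0%R, (2 * pi)%R[ `&` cos @^-1` A); last first.
    apply/seteqP; split => x; rewrite /I/= !in_itv/= mul1r cos_add_period;
      by move=> [xk cA]; split => //; lra.
  rewrite (@ge0_integral_cos_preimage_period A
    (fun x => f (1 * x + 2 * (e n)%:~R * pi)%R))//; last first.
    apply: measurableT_comp => //; apply: measurable_funD => //.
  apply: eq_integral => y _; congr (_ * (f _ + f _))%E; ring.
rewrite -integral_nneseries//; last 3 first.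
- exact: measurableI.
- by move=> n; exact: mGA.
- by move=> n y _; rewrite mule_ge0 ?inv_sqrt_ge0// adde_ge0.
rewrite integral_mkcondl; apply: eq_integral => y _.
rewrite patchE /on_unit ltr_norml.
have -> : (y \in `](-1)%R, 1%R[%classic) = (-1 < y < 1).
  by apply/idP/idP; rewrite inE/= in_itv.
case: ifPn => // _; rewrite nneseriesZl; last by move=> n _; rewrite adde_ge0.
by congr (_ * _)%E; rewrite esum_int// => k; rewrite adde_ge0.
Qed.

End cos_preimage.

(** * Sequences of increments *)

Section even_occupation.
Local Open Scope nat_scope.

(* [b] lists the increments of N over successive time steps, the last one
   first; the steps that start with an even value of N are counted. *)
Fixpoint even_occupation (b : seq bool) : nat :=
  if b is x :: b' then even_occupation b' + ~~ odd (count id b') else 0.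

Fixpoint bitseqs (n : nat) : seq (seq bool) :=
  if n is n'.+1 then
    [seq false :: b | b <- bitseqs n'] ++ [seq true :: b | b <- bitseqs n']
  else [:: [::]].

Definition count_occupation (n k j : nat) : nat :=
  count (fun b => (count id b == k) && (even_occupation b == j)) (bitseqs n).

Lemma mem_bitseqs n b : (b \in bitseqs n) = (size b == n).
Proof.
elim: n b => [|n ih] [|x b]//=.
  by rewrite mem_cat; apply/negbTE/norP; split; apply/mapP => -[].
rewrite mem_cat eqSS -ih; case: x.
  rewrite orbC mem_map; last by move=> ? ? [].
  by case: (_ \in bitseqs n) => //=; apply/mapP => -[].
rewrite mem_map; last by move=> ? ? [].
by case: (_ \in bitseqs n) => //=; apply/mapP => -[].
Qed.

(** Splits on the last increment; the last step is counted when the number of ones before it is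
    even. The factor [0 < j] removes the case in which [j.-1] would be truncated. *)
Lemma count_occupationS n k j : count_occupation n.+1 k.+1 j =
  (if odd k.+1 then count_occupation n k.+1 j
   else (0 < j) * count_occupation n k.+1 j.-1) +
  (if odd k then count_occupation n k j else (0 < j) * count_occupation n k j.-1).
Proof.
have H i (l : nat): count (fun b => (count id b == i) &&
      (even_occupation b + ~~ odd (count id b) == l)) (bitseqs n) =
    if odd i then count_occupation n i l else (0 < l) * count_occupation n i l.-1.
  rewrite /count_occupation; case: ifP => oi.
    apply: eq_count => b; case: eqP => //= ->; by rewrite oi addn0.
  case: l => [|l]/=.
    rewrite (@eq_count _ _ pred0) ?count_pred0// => b /=.
    by case: eqP => //= ->; rewrite oi addn1.
  rewrite mul1n; apply: eq_count => b.
  by case: eqP => //= ->; rewrite oi addn1.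
by rewrite {1}/count_occupation/= count_cat !count_map -!H.
Qed.

Lemma count_occupation0 n j : count_occupation n 0 j = (j == n).
Proof.
elim: n j => [|n ih] j; first by rewrite /count_occupation/= addn0 eq_sym.
rewrite /count_occupation/= count_cat !count_map/= [X in _ + X](_ : _ = 0).
  rewrite addn0; case: j => [|j].
    rewrite (@eq_count _ _ pred0) ?count_pred0// => b /=.
    by rewrite add0n; case: eqP => //= ->; rewrite addn1.
  rewrite eqSS -ih /count_occupation; apply: eq_count => b /=.
  by rewrite add0n; case: eqP => //= ->; rewrite addn1.
by rewrite (@eq_count _ _ pred0) ?count_pred0.
Qed.

(* A sequence is determined by the lengths of the blocks on which N is even and
   odd, hence the products of numbers of compositions. *)
Lemma count_occupationE n m j :
  count_occupation n m.*2.+1 j =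
    (0 < j <= n) * ('C(j.-1, m) * 'C(n - j, m)) /\
  count_occupation n m.*2.+2 j = (j < n) * ('C(j, m.+1) * 'C(n - j.+1, m)).
Proof.
elim: n m j => [|n ih] m j.
  by rewrite /count_occupation/=; case: j.
rewrite !count_occupationS /= odd_double/=; split.
  have [ih1 _] := ih m j; rewrite ih1.
  have -> : count_occupation n m.*2 j.-1 =
      if m is m'.+1 then (j.-1 < n) * ('C(j.-1, m) * 'C(n - j, m'))
      else (j.-1 == n).
    case: m {ih1} => [|m]; first exact: count_occupation0.
    by have [_ ->] := ih m j.-1; case: j => //=; rewrite subn1 bin0n !muln0.
  case: j {ih1} => [|j]//=; rewrite !mul1n.
  (* Pascal's rule on the second binomial needs [n - j] to be a successor, so the boundary [j = n]
     is treated apart. *)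
  have [jn|jn|jn] := ltngtP j n.
  - rewrite ltnS (ltnW jn) !mul1n subSS.
    case: m => [|m]; first by rewrite !bin0.
    have -> : n - j = (n - j.+1).+1 by lia.
    by rewrite mul1n binS mulnDr.
  - by rewrite ltnS leqNgt jn; case: m.
  - rewrite jn ltnSn subSS subnn mul0n !mul1n add0n.
    by case: m => [|m]; rewrite ?bin0// bin0n !muln0.
have [_ ih2] := ih m j.-1; have [ih1 _] := ih m j; rewrite ih1 ih2.
case: j {ih1 ih2} => [|j]/=; first by rewrite bin0n !muln0.
rewrite mul1n !ltnS subSS; have [jn|jn] := ltnP j n; last by [].
by rewrite !mul1n binS mulnDl.
Qed.

End even_occupation.

(** * From numbers of sequences to the limiting density *)

Section occupation_density.
Context (R : realType).
Local Notation lebesgue := (@lebesgue_measure R).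
Implicit Types (t h w : R) (k n : nat).

(* Up to the factor exp(- lam t) lam^(k+1), the density on {N t = k+1} of the time
   spent by N in even values. *)
Definition occupation_density k t w : R :=
  if 0 < w < t then
    w ^+ uphalf k * (t - w) ^+ k./2 / ((uphalf k)`!%:R * (k./2)`!%:R)
  else 0.

Lemma occupation_density_ge0 k t w : 0 <= occupation_density k t w.
Proof.
rewrite /occupation_density; case: ifP => // /andP[w0 wt].
by rewrite divr_ge0// ?mulr_ge0// exprn_ge0 ?subr_ge0// ltW.
Qed.

Lemma measurable_occupation_density k t :
  measurable_fun [set: R] (occupation_density k t).
Proof.
apply: measurable_fun_if => //.
  by apply: measurable_and; exact: measurable_fun_ltr.
apply: measurable_funTS; apply: measurable_funM => //.
by apply: measurable_funM => //; apply: measurable_funX => //; exact: measurable_funB.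
Qed.

Lemma leq_bin_exp (n m : nat) : ('C(n, m) * m`! <= n ^ m)%N.
Proof.
rewrite bin_ffact; elim: m n => [|m ih] n; first by rewrite ffactn0.
rewrite ffactnS expnS leq_mul2l (leq_trans (ih _))?orbT//.
by case: m {ih} => // m; rewrite leq_exp2r// leq_pred.
Qed.

(** A binomial coefficient is at most i^m / m!, and i h <= w; this is the whole comparison of
    discrete weights with the density. *)
Lemma bin_mul_exp_le (i m : nat) h w : 0 <= h -> i%:R * h <= w ->
  'C(i, m)%:R * h ^+ m <= w ^+ m / m`!%:R.
Proof.
move=> h0 ihw; rewrite ler_pdivlMr ?ltr0n ?fact_gt0// mulrAC -natrM.
apply: (@le_trans _ _ ((i ^ m)%N%:R * h ^+ m)).
  by rewrite ler_wpM2r ?exprn_ge0// ler_nat leq_bin_exp.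
rewrite natrX -exprMn lerXn2r// nnegrE ?mulr_ge0//.
by rewrite (le_trans _ ihw)// mulr_ge0.
Qed.

Lemma uphalf_half_sum k : (uphalf k + k./2)%N = k.
Proof. by rewrite uphalf_half -addnA addnn odd_double_half. Qed.

Lemma expr_uphalf_half k t : t ^+ k = t ^+ uphalf k * t ^+ k./2.
Proof. by rewrite -exprD uphalf_half_sum. Qed.

(** Taking j = i + 1 for even [k] and j = i for odd [k] merges the two closed formulas into one
    product, with exponents matching those of [occupation_density]. *)
Lemma count_occupation_bin n k i : (i < n)%N ->
  count_occupation n k.+1 (i + ~~ odd k) =
    ('C(i, uphalf k) * 'C(n - i.+1, k./2))%N.
Proof.
move=> ni; have [ko|ke] := boolP (odd k).
  have -> : k = k./2.*2.+1 by have := odd_double_half k; lia.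
  have [_ ->] := count_occupationE n k./2 (i + 0).
  by rewrite /= uphalf_double half_double addn0 ni mul1n.
have -> : k = k./2.*2 by have := odd_double_half k; lia.
have [-> _] := count_occupationE n k./2 (i + 1).
by rewrite uphalf_double half_double addn1/= ni mul1n.
Qed.

(* Shifting the cell by one step when k is even makes the discrete weight a lower
   bound of the density, with no error term. *)
Lemma count_occupation_le_density n k i t h w : 0 <= h -> t = n%:R * h ->
  (i < n)%N -> i%:R * h < w < i.+1%:R * h ->
  h ^+ k * (count_occupation n k.+1 (i + ~~ odd k))%:R <= occupation_density k t w.
Proof.
move=> h0 tE ni /andP[iw wi].
have n1 : (n - i.+1)%:R * h <= t - w.
  by rewrite tE natrB// mulrBl lerD2l lerN2 ltW.
rewrite /occupation_density ifT; last first.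
  apply/andP; split; first by rewrite (le_lt_trans _ iw)// mulr_ge0.
  by rewrite (lt_le_trans wi)// tE ler_wpM2r// ler_nat.
rewrite count_occupation_bin// expr_uphalf_half natrM.
rewrite mulrACA [leLHS](_ : _ = 'C(i, uphalf k)%:R * h ^+ uphalf k *
  ('C(n - i.+1, k./2)%:R * h ^+ k./2)); last by ring.
rewrite [leRHS](_ : _ = w ^+ uphalf k / (uphalf k)`!%:R *
  ((t - w) ^+ k./2 / (k./2)`!%:R)); last by rewrite invfM; ring.
by rewrite ler_pM// ?mulr_ge0 ?exprn_ge0// bin_mul_exp_le// ltW.
Qed.

(** A crude bound, which makes the contribution of a short interval small. *)
Lemma occupation_density_le k t w : 0 <= t -> occupation_density k t w <= t ^+ k.
Proof.
move=> t0; rewrite /occupation_density; case: ifP => [/andP[w0 wt]|_]; last first.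
  exact: exprn_ge0.
  rewrite ler_pdivrMr ?mulr_gt0 ?ltr0n ?fact_gt0//.
  rewrite (expr_uphalf_half k t).
  apply: (@le_trans _ _ (t ^+ uphalf k * t ^+ k./2)).
    apply: ler_pM.
    - by rewrite exprn_ge0// ltW.
    - by rewrite exprn_ge0// subr_ge0 ltW.
    - by rewrite lerXn2r// ?nnegrE ltW.
    - by rewrite lerXn2r// ?nnegrE ?subr_ge0 ?gerBl ltW.
  rewrite ler_peMr ?mulr_ge0 ?exprn_ge0 ?(ltW (lt_trans w0 wt))//.
  by rewrite -natrM ler1n muln_gt0 !fact_gt0.
Qed.

(** After scaling by [t] this is the Beta integral a! b! / (a + b + 1)! with a + b = k. *)
Lemma integral_occupation_density k t : 0 < t ->
  (\int[lebesgue]_w (occupation_density k t w)%:E = (t ^+ k.+1 / k.+1`!%:R)%:E)%E.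
Proof.
move=> t0.
rewrite (@integral_affine _ t 0)//; last 3 first.
- by rewrite gt_eqF.
- by apply/measurable_EFinP; exact: measurable_occupation_density.
- by move=> w; rewrite lee_fin occupation_density_ge0.
rewrite gtr0_norm// preimage_setT.
pose a := uphalf k; pose b := k./2.
pose C : R := t ^+ k / (a`!%:R * b`!%:R).
have C0 : 0 <= C by rewrite divr_ge0// exprn_ge0// ltW.
have mX : measurable_fun [set: R] (@XMonemX R a b).
  by apply: measurable_funM; apply: measurable_funX => //; exact: measurable_funB.
transitivity (t%:E * \int[lebesgue]_(x in `]0%R, 1%R[) (C%:E * (XMonemX a b x)%:E))%E.
  congr (_ * _)%E; rewrite [RHS]integral_mkcond; apply: eq_integral => x _.
  rewrite patchE /occupation_density addr0 pmulr_rgt0// gtr_pMr//.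
  rewrite mem_setE in_itv/=; case: ifPn => // _.
  rewrite -EFinM; congr (_%:E); rewrite /C /XMonemX -/a -/b -[unstable.onem x]/(1 - x).
  have -> : t - t * x = t * (1 - x) by ring.
  rewrite !exprMn.
  by rewrite (expr_uphalf_half k t); ring.
rewrite ge0_integralZl//; last 2 first.
- by apply/measurable_EFinP; exact: measurable_funTS.
- by move=> x /=; rewrite in_itv/= => ?; rewrite lee_fin XMonemX_ge0// in_itv/=; lra.
rewrite -(@integral_itv_bndoo _ 0 1 _ true false)//; last first.
  by apply/measurable_EFinP; exact: measurable_funTS.
have -> : (\int[lebesgue]_(x in `[0%R, 1%R]) (XMonemX a b x)%:E =
    (beta_fun a.+1 b.+1)%:E)%E.
  rewrite EFin_beta_fun integral_mkcond; apply: eq_integral => x _.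
  by rewrite !patchE; case: ifPn.
rewrite beta_fun_fact -!EFinM; congr (_%:E).
rewrite /C uphalf_half_sum natrM exprS.
have := fact_gt0 a; have := fact_gt0 b; have := fact_gt0 k.+1.
rewrite -!(ltr0n R) => k0 b0 a0.
by field; rewrite !gt_eqF.
Qed.

End occupation_density.

Lemma count_le_sum (T : eqType) (p : pred T) (q : nat -> pred T) (r : seq nat)
    (s : seq T) :
  (forall b, b \in s -> p b -> has (q^~ b) r) ->
  (count p s <= \sum_(i <- r) count (q i) s)%N.
Proof.
elim: s => [|b s ih]//= H; rewrite big_split/= leq_add ?ih//; last first.
  by move=> c cs; apply: H; rewrite inE cs orbT.
have [/(H _ (mem_head _ _))/hasP[i ir qi]|//] := boolP (p b).
by rewrite (big_rem i)//= qi.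
Qed.

Section sum_bitseqs.
Context (R : realType).
Local Notation lebesgue := (@lebesgue_measure R).

(** A sequence with occupation j is charged to the cell of index j - [~~ odd k]. The pointwise bound
    on the weights is integrated over each cell, and the cells involved are disjoint and lie in
    [B]. *)
Lemma count_bitseqs_le_integral (n k : nat) (h t : R) (P : pred nat) (B : set R) :
  0 < h -> t = n%:R * h -> measurable B ->
  (forall i, (i < n)%N -> P (i + ~~ odd k)%N ->
     forall w, i%:R * h < w < i.+1%:R * h -> B w) ->
  ((h ^+ k.+1 * (count (fun b => (count id b == k.+1) && P (even_occupation b))
      (bitseqs n))%:R)%:E <=
   \int[lebesgue]_(w in B) (occupation_density k t w)%:E)%E.
Proof.
move=> h0 tE mB PB.
pose r := [seq i <- iota 0 n | P (i + ~~ odd k)%N].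
pose cell i : set R := `](i%:R * h), (i.+1%:R * h)[%classic.
have md D : measurable_fun D (fun w => (occupation_density k t w)%:E).
  by apply/measurable_EFinP; apply: measurable_funTS; exact: measurable_occupation_density.
have d0 w : (0 <= (occupation_density k t w)%:E)%E.
  by rewrite lee_fin occupation_density_ge0.
have rn i : i \in r -> (i < n)%N /\ P (i + ~~ odd k)%N.
  by rewrite mem_filter mem_iota => /andP[-> /andP[_ +]]; rewrite add0n => ->.
apply: (@le_trans _ _ (\sum_(i <- r) \int[lebesgue]_(w in cell i)
    (occupation_density k t w)%:E)%E); last first.
  have mcell i : measurable (cell i : set (measurableTypeR R)).
    exact: measurable_itv.
  rewrite -(@ge0_integral_bigsetU _ _ _ lebesgue _ cell _ r mcell)//.
  - apply: ge0_subset_integral => //.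
    - by apply: bigsetU_measurable => i _; exact: measurable_itv.
    - exact: md.
    move=> w; rewrite -bigcup_seq => -[i /rn[ni Pi]] /=.
    by rewrite /cell/= in_itv/=; exact: PB.
  - by rewrite filter_uniq// iota_uniq.
  - apply/trivIsetP => i j _ _ ij.
    rewrite -subset0 => w [].
    rewrite /cell/= !in_itv/= => /andP[iw wi] /andP[jw wj].
    have := lt_trans iw wj; have := lt_trans jw wi.
    by rewrite !ltr_pM2r// !ltr_nat; lia.
  - exact: md.
apply: (@le_trans _ _ (\sum_(i <- r)
    (h ^+ k.+1 * (count_occupation n k.+1 (i + ~~ odd k))%:R)%:E)%E).
  rewrite sumEFin lee_fin -mulr_sumr ler_wpM2l ?exprn_ge0 ?(ltW h0)//.
  rewrite -natr_sum ler_nat; apply: count_le_sum => b bn /andP[/eqP kb Pb].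
  have : (0 < count_occupation n k.+1 (even_occupation b))%N.
    rewrite /count_occupation -has_count; apply/hasP; exists b => //.
    by rewrite kb !eqxx.
  move: Pb; set j := even_occupation b => Pj cj.
  (* The closed formulas vanish outside this range, so an existing sequence has an admissible
     cell. *)
  have [jn js] : (j - ~~ odd k < n)%N /\ (~~ odd k <= j)%N.
    move: cj; have := odd_double_half k; case: (odd k) => /= <-.
      by have [_ ->] := count_occupationE n k./2 j; case: ltnP => //; lia.
    by have [-> _] := count_occupationE n k./2 j; case: (boolP (_ < _ <= _)%N) => //; lia.
  apply/hasP; exists (j - ~~ odd k)%N; last by rewrite kb subnK ?eqxx.
  by rewrite mem_filter subnK// Pj mem_iota.
rewrite !big_seq; apply: lee_sum => i /rn[ni _].
(* One of the [k.+1] factors [h] is the length of the cell; the other [k] belong to the pointwise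
   bound. *)
rewrite exprS -mulrA mulrC EFinM.
have -> : (h%:E = lebesgue (cell i))%E.
  rewrite lebesgue_measure_itv/= lte_fin ltr_pM2r// ltr_nat ltnSn -EFinB.
  by rewrite -mulrBl -natrB// subSnn mul1r.
have mcell : measurable (cell i : set (measurableTypeR R)).
  exact: measurable_itv.
rewrite -integral_cst//; apply: ge0_le_integral => //.
- by move=> w _; rewrite lee_fin mulr_ge0// exprn_ge0// ltW.
- exact: md.
- move=> w; rewrite /cell/= in_itv/= => iw; rewrite lee_fin.
  by apply: count_occupation_le_density => //; exact: ltW.
Qed.

End sum_bitseqs.

(** * Even time of a Poisson process *)

Section path_sign.
Context (R : realType) (g : R -> nat).
Hypothesis g_nd : forall s t : R, 0 <= s -> s <= t -> (g s <= g t)%N.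
Local Notation lebesgue := (@lebesgue_measure R).
Implicit Types (s t h : R).

Lemma cos_mulpi (n : nat) : cos (pi * n%:R) = (-1) ^+ n :> R.
Proof.
elim: n => [|n ih]; first by rewrite mulr0 cos0.
by rewrite -natr1 mulrDr mulr1 cosDpi ih exprSr mulrN1.
Qed.

(** Monotone functions are measurable and (-1)^n = cos(pi n); replacing s by max(0, s) makes [g]
    monotone on the whole line. *)
Lemma measurable_path_sign (D : set R) : measurable D -> D `<=` `[0, +oo[ ->
  measurable_fun D (fun s => (-1) ^+ g s : R).
Proof.
move=> mD D0.
pose f s : R := cos (pi * (g (Num.max 0 s))%:R).
have mf : measurable_fun D f.
  apply: measurableT_comp; first exact: measurable_cos.
  apply: measurable_funM => //; apply: nondecreasing_measurable => // s t st.
  rewrite ler_nat; apply: g_nd; first by rewrite le_max lexx.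
  by rewrite ge_max !le_max lexx st orbT.
apply: eq_measurable_fun mf => s /[!inE] /D0/=; rewrite in_itv/= andbT => s0.
by rewrite /f cos_mulpi max_r.
Qed.

Lemma integrable_itv_cst (a : R) (i : interval R) u v :
  [set` i] `<=` `[u, v] -> lebesgue.-integrable [set` i] (EFin \o cst a).
Proof.
move=> iuv; apply: (@integrableS _ (measurableTypeR R) R lebesgue `[u, v] [set` i]
  (EFin \o cst a) (measurable_itv `[u, v]) (measurable_itv i) iuv).
apply: continuous_compact_integrable; first exact: segment_compact.
by apply: continuous_subspaceT => x; exact: cvg_cst.
Qed.

Lemma integrable_path_sign (i : interval R) t : [set` i] `<=` `[0, t] ->
  lebesgue.-integrable [set` i] (EFin \o (fun s => (-1) ^+ g s : R)).
Proof.
move=> it; apply: (@le_integrable _ (measurableTypeR R) R lebesgue [set` i] _ _ (EFin \o cst 1)) => //.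
- apply/measurable_EFinP; apply: measurable_path_sign => // s /it/=.
  by rewrite !in_itv/= => /andP[->].
- by move=> s _ /=; rewrite normrX normrN1 expr1n normr1.
- exact: integrable_itv_cst it.
Qed.

(** A step on which [g] does not change contributes no error. Any other step contributes at most 2h,
    and [g] grows by at least 1 there, so the increase of [g] bounds the number of such steps. *)
Lemma path_sign_riemann (n : nat) h : 0 <= h ->
  `| \int[lebesgue]_(s in `[0, n%:R * h]) ((-1) ^+ g s)
     - h * \sum_(i < n) (-1) ^+ g (i%:R * h) | <=
  2 * h * (g (n%:R * h) - g 0)%N%:R.
Proof.
move=> h0; elim: n => [|n ih].
  by rewrite mul0r set_itv1 Rintegral_set1 big_ord0 mulr0 subr0 normr0 subnn mulr0.
have nh0 : 0 <= n%:R * h by rewrite mulr_ge0.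
have nh1 : n%:R * h <= n.+1%:R * h by rewrite ler_wpM2r// ler_nat.
pose f s : R := (-1) ^+ g s.
pose I0 := \int[lebesgue]_(s in `[0, n%:R * h]) f s.
pose I1 := \int[lebesgue]_(s in `](n%:R * h), (n.+1%:R * h)]) f s.
pose S : R := h * \sum_(i < n) f (i%:R * h).
have IE : \int[lebesgue]_(s in `[0, n.+1%:R * h]) f s = I1 + I0.
  have int1 := @integrable_path_sign `[0, n.+1%:R * h] (n.+1%:R * h) (@subset_refl _ _).
  have := @Rintegral_itvB _ f (BLeft 0) (BRight (n.+1%:R * h)) (n%:R * h) int1.
  by rewrite !bnd_simp => /(_ nh0 nh1); rewrite -/I1 -/I0 => <-; rewrite subrK.
rewrite -[X in `|X - _|]/(\int[lebesgue]_(s in `[0, n.+1%:R * h]) f s) IE.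
rewrite big_ord_recr/= mulrDr -/S.
have -> : I1 + I0 - (S + h * (-1) ^+ g (n%:R * h)) =
    I0 - S + (I1 - h * (-1) ^+ g (n%:R * h)) by ring.
rewrite (le_trans (ler_normD _ _))//.
have gn : (g 0 <= g (n%:R * h))%N by exact: g_nd.
have gn1 : (g (n%:R * h) <= g (n.+1%:R * h))%N by exact: g_nd.
rewrite (_ : (g (n.+1%:R * h) - g 0 =
  (g (n%:R * h) - g 0) + (g (n.+1%:R * h) - g (n%:R * h)))%N); last by lia.
rewrite natrD mulrDr lerD//.
have lI : lebesgue `](n%:R * h)%R, (n.+1%:R * h)%R] = h%:E.
  rewrite lebesgue_measure_itv/= lte_fin; have [_|] := ltP (n%:R * h).
    by rewrite -EFinB; congr EFin; rewrite -natr1; ring.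
  by move=> hn; congr EFin; move: hn; rewrite -natr1; lra.
have isub : [set` `](n%:R * h)%R, (n.+1%:R * h)%R]] `<=` `[0, n.+1%:R * h].
  by move=> s /=; rewrite !in_itv/=; lra.
have hE : h * (-1) ^+ g (n%:R * h) =
    \int[lebesgue]_(s in `](n%:R * h), (n.+1%:R * h)]) ((-1) ^+ g (n%:R * h)).
  by rewrite Rintegral_cst// mulrC; congr (_ * _); exact: (congr1 fine (esym lI)).
have [gE|gN] := eqVneq (g (n.+1%:R * h)) (g (n%:R * h)).
  rewrite gE subnn mulr0 hE /I1 (@eq_Rintegral _ _ _ _ _ (fun=> (-1) ^+ g (n%:R * h))).
    by rewrite subrr normr0.
  move=> s; rewrite inE/= in_itv/= => /andP[ns sn].
  congr (_ ^+ _); apply/eqP; rewrite eqn_leq (g_nd nh0 (ltW ns)) andbT.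
  by rewrite -gE; apply: g_nd => //; lra.
apply: (@le_trans _ _ (2 * h)); last first.
  by rewrite ler_peMr ?mulr_ge0// ler1n subn_gt0 ltn_neqAle eq_sym gN.
rewrite mulr2n mulrDl mul1r (le_trans (ler_normB _ _))// lerD//.
  apply: (le_trans (le_normr_Rintegral _ (integrable_path_sign isub))) => //.
  rewrite (@eq_Rintegral _ _ _ _ _ (fun=> 1)).
    by rewrite Rintegral_cst// mul1r (congr1 fine lI).
  by move=> s _; rewrite normrX normrN1 expr1n.
by rewrite normrM normrX normrN1 expr1n mulr1 ger0_norm.
Qed.

End path_sign.

Section increments.
Local Open Scope nat_scope.

Lemma increments_even_occupation (b : seq bool) (a : nat -> nat) :
  a 0 = 0 -> (forall i, a i <= a i.+1) ->
  (forall i, i < size b -> a i.+1 - a i = nth false (rev b) i) ->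
  a (size b) = count id b /\
  \sum_(i < size b) ~~ odd (a i) = even_occupation b.
Proof.
move=> a0 nd; elim: b => [|x b ih] H; first by rewrite big_ord0.
have [|aE oE] := ih.
  move=> i ib; rewrite H/=; last exact: ltnW.
  by rewrite rev_cons nth_rcons size_rev ib.
split; last by rewrite big_ord_recr/= oE aE.
have := H (size b) (ltnSn _); rewrite rev_cons nth_rcons size_rev ltnn eqxx /= => <-.
by rewrite -aE addnC subnKC.
Qed.

End increments.

Section signed_time.
Context (R : realType) (d : measure_display) (T : measurableType d).
Variables (P : probability T R) (lam : R) (N : R -> T -> nat).
Hypothesis N_poisson : poisson_process P lam N.
Local Notation lebesgue := (@lebesgue_measure R).
Implicit Types (t h : R) (w : T).

Definition signed_time t w : R :=
  \int[lebesgue]_(s in `[0, t]) ((-1) ^+ N s w).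

(** The even and odd times add up to t and differ by [signed_time], so this is the time spent in
    even values. *)
Definition even_time t w : R := (t + signed_time t w) / 2.

Let N_nd w s t : 0 <= s -> s <= t -> (N s w <= N t w)%N.
Proof. exact: (poisson_nondecreasing N_poisson). Qed.

Lemma telegraphE (V0 : T -> R) t w :
  telegraph N V0 t w = V0 w * signed_time t w.
Proof.
rewrite /telegraph /velocity RintegralZl//.
exact: (@integrable_path_sign _ (N^~ w) (@N_nd w) `[0, t] t).
Qed.

Lemma signed_time_riemann (n : nat) h w : 0 <= h ->
  `|signed_time (n%:R * h) w - h * \sum_(i < n) (-1) ^+ N (i%:R * h) w|
    <= 2 * h * (N (n%:R * h) w)%:R.
Proof.
move=> h0; have := @path_sign_riemann _ (N^~ w) (@N_nd w) n h h0.
by rewrite (poisson_start N_poisson) subn0.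
Qed.

Lemma even_time_riemann (n : nat) h w : 0 <= h ->
  `|even_time (n%:R * h) w - h * (\sum_(i < n) ~~ odd (N (i%:R * h) w))%:R|
    <= h * (N (n%:R * h) w)%:R.
Proof.
move=> h0; have := signed_time_riemann n w h0.
have -> : \sum_(i < n) (-1) ^+ N (i%:R * h) w =
    2 * (\sum_(i < n) ~~ odd (N (i%:R * h) w))%:R - n%:R :> R.
  rewrite natr_sum mulr_sumr -[in n%:R](card_ord n) -sum1_card natr_sum -sumrB.
  apply: eq_bigr => i _; rewrite -signr_odd; case: odd => /=.
    by rewrite expr1 mulr0 sub0r.
  by rewrite expr0 mulr1 -[2]/(1 + 1) addrK.
rewrite /even_time; set E : R := (\sum_(i < n) _)%:R; set M : R := (N _ _)%:R.
set S := signed_time _ _ => H.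
have -> : (n%:R * h + S) / 2 - h * E = (S - h * (2 * E - n%:R)) / 2 by field.
by rewrite normrM normfV (ger0_norm (ler0n _ 2)) ler_pdivrMr//; lra.
Qed.

Let G : set (set T) := \bigcup_(t in [set t : R | 0 <= t])
  preimage_set_system [set: T] (N t) measurable.

(** Measurability is needed for the sigma-algebra generated by N, the one for which V(0) is
    independent; it follows from pointwise convergence of Riemann sums. *)
Lemma measurable_signed_time_process t : 0 <= t ->
  measurable_fun [set: g_sigma_algebraType G] (signed_time t : g_sigma_algebraType G -> R).
Proof.
move=> t0.
pose h (n : nat) : R := t / n.+1%:R.
have th n : n.+1%:R * h n = t by rewrite /h mulrC divfK.
apply: (@measurable_fun_cvg _ (g_sigma_algebraType G) R setT
  (fun n w => h n * \sum_(i < n.+1) (-1) ^+ N (i%:R * h n) w)) => [n|w _].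
  apply: measurable_funM => //; apply: measurable_sum => i.
  have -> : (fun w => (-1) ^+ N (i%:R * h n) w : R) =
      (fun m : nat => (-1) ^+ m : R) \o N (i%:R * h n) by [].
  apply: (@measurableT_comp _ _ _ _ _ _ (fun m : nat => (-1) ^+ m : R)) => //.
  move=> _ Y mY; apply: sub_sigma_algebra.
  exists (i%:R * h n); first by rewrite /= mulr_ge0// divr_ge0.
  by exists Y.
apply/cvgrPdist_le => e e0; near=> n.
(* For a fixed path the error is at most 2 t N(t) / (n + 1), which tends to 0. *)
rewrite -{1}(th n) (le_trans (signed_time_riemann _ _ _))//; first by rewrite divr_ge0.
rewrite th /h mulrAC mulrA ler_pdivrMr// mulrAC.
have -> : 2 * t * (N t w)%:R = e * (2 * t * (N t w)%:R / e).
  by field; rewrite gt_eqF.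
rewrite ler_pM2l//.
near: n; exists (Num.truncn (2 * t * (N t w)%:R / e)) => // n /= nn.
by rewrite ltW// (lt_le_trans (truncnS_gt _))// ler_nat ltnS.
Unshelve. all: by end_near. Qed.

Lemma process_sigma_even_time t (B : set R) : 0 <= t -> measurable B ->
  process_sigma N (even_time t @^-1` B).
Proof.
move=> t0 mB.
have : measurable_fun [set: g_sigma_algebraType G] (even_time t : g_sigma_algebraType G -> R).
  apply: measurable_funM => //; apply: measurable_funD => //.
  exact: measurable_signed_time_process.
by move=> /(_ measurableT B mB); rewrite setTI.
Qed.

Lemma process_sigma_measurable A : process_sigma N A -> measurable A.
Proof.
apply: smallest_sub; first exact: sigma_algebra_measurable.
move=> _ [t /= t0 [Y mY <-]]; rewrite setTI.
by have := poisson_measurable N_poisson t0 measurableT mY; rewrite setTI.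
Qed.

Lemma measurable_even_time t : 0 <= t -> measurable_fun [set: T] (even_time t).
Proof.
move=> t0 _ B mB; rewrite setTI; apply: process_sigma_measurable.
exact: process_sigma_even_time.
Qed.

End signed_time.

Lemma measure_bigsetU_le (R : realType) d (T : measurableType d)
    (m : {measure set T -> \bar R}) (I : Type) (r : seq I) (F : I -> set T) :
  (forall i, measurable (F i)) ->
  (m (\big[setU/set0]_(i <- r) F i) <= \sum_(i <- r) m (F i))%E.
Proof.
move=> mF; elim: r => [|i r ih]; first by rewrite !big_nil measure0.
rewrite !big_cons (le_trans (measureU2 _ _ _))//.
  by apply: bigsetU_measurable.
by rewrite leeD2l.
Qed.

(** * Discretization into steps of length h *)

Section increment_events.
Context (R : realType) (d : measure_display) (T : measurableType d).
Variables (P : probability T R) (lam : R) (N : R -> T -> nat).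
Hypothesis lam_gt0 : 0 < lam.
Hypothesis N_poisson : poisson_process P lam N.
Local Notation lebesgue := (@lebesgue_measure R).
Implicit Types (t h : R) (w : T).

Definition increment h (i : nat) w : nat := (N (i.+1%:R * h) w - N (i%:R * h) w)%N.

Lemma measurable_increment h i : 0 <= h -> measurable_fun [set: T] (increment h i).
Proof.
by move=> h0; apply: measurable_fun_subn;
  apply: (poisson_measurable N_poisson); rewrite mulr_ge0.
Qed.

Lemma measurable_increment_preimage h i (Y : set nat) : 0 <= h ->
  measurable (increment h i @^-1` Y).
Proof. by move=> h0; rewrite -[X in measurable X]setTI; exact: measurable_increment. Qed.

Lemma increment_pmf h i k : 0 < h ->
  P [set w | increment h i w = k] = (poisson_pmf (lam * h) k)%:E.
Proof.
move=> h0; have hi : i%:R * h < i.+1%:R * h by rewrite ltr_pM2r// ltr_nat.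
have i0 : 0 <= i%:R * h by rewrite mulr_ge0// ltW.
rewrite (poisson_increment N_poisson k i0 hi).
by congr (poisson_pmf (lam * _) _)%:E; rewrite -natr1; ring.
Qed.

(** The reversal is due to [b] listing the last increment first. *)
Definition increments_event h (b : seq bool) : set T :=
  \bigcap_(i in [set i | (i < size b)%N]) [set w | increment h i w = nth false (rev b) i].

Lemma measurable_increments_event h b : 0 <= h -> measurable (increments_event h b).
Proof.
move=> h0; apply: bigcap_measurableType => i _.
exact: (measurable_increment_preimage i [set (nth false (rev b) i : nat)] h0).
Qed.

Lemma poisson_pmf_bool h (x : bool) : 0 < h ->
  poisson_pmf (lam * h) x = expR (- (lam * h)) * (lam * h) ^+ x.
Proof.
move=> h0; rewrite /poisson_pmf mulr_gt0//.
by case: x; rewrite ?(factS 0) fact0 invr1 mulr1 mulrC.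
Qed.

Lemma probability_increments_event h b : 0 < h ->
  P (increments_event h b) =
  (expR (- (lam * ((size b)%:R * h))) * (lam * h) ^+ count id b)%:E.
Proof.
move=> h0; set n := size b.
have inc := @poisson_independent_increments _ _ _ _ _ _ N_poisson n
  (fun i => i%:R * h).
have -> : increments_event h b =
    \bigcap_(i in [set: 'I_n]) (fun w => (N (i.+1%:R * h) w - N (i%:R * h) w)%N)
      @^-1` [set nth false (rev b) i : nat].
  apply/seteqP; split => w H i /=; first by move=> _; exact: (H i (ltn_ord i)).
  by move=> ib; exact: (H (Ordinal ib)).
rewrite inc ?mul0r//; last first.
  by move=> i _; rewrite ler_wpM2r ?ler_nat// ltW.
pose F (x : bool) : R := poisson_pmf (lam * h) x.
transitivity (\prod_(i < n) (F (nth false (rev b) i))%:E)%E.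
  by apply: eq_bigr => i _; exact: increment_pmf.
rewrite prodEFin; congr EFin.
have -> : \prod_(i < n) F (nth false (rev b) i) = \prod_(x <- b) F x.
  rewrite (perm_big (rev b)); last by rewrite perm_sym perm_rev.
  by rewrite [RHS](big_nth false) size_rev big_mkord.
rewrite /n; elim: b {inc n} => [|x b ih].
  by rewrite big_nil mul0r mulr0 oppr0 expR0 mulr1.
rewrite big_cons ih /F poisson_pmf_bool//= exprD -natr1 mulrDl mul1r mulrDr opprD.
by rewrite expRD; ring.
Qed.

Lemma probability_increment_ge2 h i : 0 < h ->
  (P [set w | (1 < increment h i w)%N] <= ((lam * h) ^+ 2)%:E)%E.
Proof.
move=> h0.
have -> : [set w | (1 < increment h i w)%N] =
    ~` (increment h i @^-1` [set 0%N; 1%N]).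
  apply/seteqP; split => w /=; first by move=> + [] => /[swap] ->.
  by case: (increment h i w) => [|[|]]//; [case; left|case; right].
rewrite probability_setC; last exact: measurable_increment_preimage (ltW h0).
have -> : P (increment h i @^-1` [set 0%N; 1%N]) =
   (expR (- (lam * h)) * (1 + lam * h))%:E.
  rewrite preimage_setU measureU.
  - rewrite [X in (X + _)%E](increment_pmf i 0 h0) [X in (_ + X)%E](increment_pmf i 1 h0).
    by rewrite -EFinD (poisson_pmf_bool false)// (poisson_pmf_bool true)//; congr EFin; ring.
  - exact: measurable_increment_preimage (ltW h0).
  - exact: measurable_increment_preimage (ltW h0).
  - by rewrite -subset0 => w [] /= ->.
rewrite -EFinB lee_fin.
have a0 : 0 < lam * h by rewrite mulr_gt0.
(* With a = lam h and exp(-a) >= 1 - a, one gets 1 - exp(-a) (1 + a) <= 1 - (1 - a) (1 + a) =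
   a^2. *)
have := expR_ge1Dx (- (lam * h)).
set a := lam * h in a0 *; set e := expR _ => e1.
by nra.
Qed.

Lemma increments_event_cover h n w : 0 <= h ->
  (forall i, (i < n)%N -> (increment h i w <= 1)%N) ->
  exists2 b, b \in bitseqs n & increments_event h b w.
Proof.
move=> h0 H; exists (rev (mkseq (fun i => increment h i w == 1)%N n)).
  by rewrite mem_bitseqs size_rev size_mkseq.
move=> i /=; rewrite size_rev size_mkseq revK => ni.
by rewrite nth_mkseq//; have := H _ ni; case: (increment h i w) => [|[|]].
Qed.

Lemma increments_event_values h b w : 0 <= h -> increments_event h b w ->
  N ((size b)%:R * h) w = count id b /\
  (\sum_(i < size b) ~~ odd (N (i%:R * h) w))%N = even_occupation b.
Proof.
move=> h0 H; apply: (@increments_even_occupation b (fun i => N (i%:R * h) w)).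
- by rewrite mul0r (poisson_start N_poisson).
- move=> i; apply: (poisson_nondecreasing N_poisson); first by rewrite mulr_ge0.
  by rewrite ler_wpM2r// ler_nat.
- by move=> i ib; exact: H.
Qed.

(** Either some step has two jumps or more, which costs at most n (lam h)^2, or the increments form
    a sequence of bits. In [k.+2] steps of tolerance, [k.+1] come from the Riemann error on {N t = k
    + 1} and one from the position inside a cell. *)
Lemma even_time_le_integral (n k : nat) h t (D B : set R) :
  0 < h -> t = n%:R * h -> measurable D -> measurable B ->
  (forall v u, D v -> `|v - u| <= k.+2%:R * h -> B u) ->
  (P [set w | D (even_time N t w) /\ N t w = k.+1] <=
   (n%:R * (lam * h) ^+ 2)%:E +
   (expR (- (lam * t)) * lam ^+ k.+1)%:E *
     \int[lebesgue]_(w in B) (occupation_density k t w)%:E)%E.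
Proof.
move=> h0 tE mD mB DB; have h0' := ltW h0.
pose Pj (j : nat) := `[< exists2 v, D v & `|v - h * j%:R| <= h * k.+1%:R >].
pose p b := (count id b == k.+1) && Pj (even_occupation b).
pose U1 := \big[setU/set0]_(i <- iota 0 n) [set w | (1 < increment h i w)%N].
pose U2 := \big[setU/set0]_(b <- [seq b <- bitseqs n | p b]) increments_event h b.
have m1 i : measurable [set w | (1 < increment h i w)%N].
  exact: (measurable_increment_preimage i [set m | (1 < m)%N] h0').
have mU1 : measurable U1 by exact: bigsetU_measurable.
have mU2 : measurable U2.
  by apply: bigsetU_measurable => b _; exact: measurable_increments_event.
have mX : measurable [set w | D (even_time N t w) /\ N t w = k.+1].
  have t0 : 0 <= t by rewrite tE mulr_ge0.
  apply: measurableI.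
    by rewrite -[X in measurable X]setTI; exact: (measurable_even_time N_poisson).
  rewrite -[X in measurable X]setTI.
  exact: (poisson_measurable N_poisson t0 measurableT (Y := [set k.+1])).
have sub : [set w | D (even_time N t w) /\ N t w = k.+1] `<=` U1 `|` U2.
  move=> w [Dw Nw].
  have [/existsP[i i2]|] := boolP [exists i : 'I_n, (1 < increment h i w)%N].
    left; rewrite /U1 -bigcup_seq; exists (i : nat) => //=.
    by rewrite mem_iota add0n ltn_ord.
  rewrite negb_exists => /forallP small; right.
  have [|b bn bw] := @increments_event_cover h n w h0'.
    by move=> i ni; have := small (Ordinal ni); rewrite -leqNgt.
  have := bn; rewrite mem_bitseqs => /eqP sb.
  have [Nb ob] := increments_event_values h0' bw.
  rewrite /U2 -bigcup_seq; exists b => //=; rewrite mem_filter bn andbT /p.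
  rewrite -Nb sb -tE Nw eqxx/=; apply/asboolP; exists (even_time N t w) => //.
  have := even_time_riemann N_poisson n w h0'.
  by rewrite -tE Nw -ob sb.
apply: (@le_trans _ _ (P U1 + P U2)%E).
  by rewrite (le_trans _ (measureU2 _ _ _))// le_measure ?inE//; exact: measurableU.
apply: leeD.
  rewrite (le_trans (measure_bigsetU_le _ _ m1))//.
  apply: (@le_trans _ _ (\sum_(i <- iota 0 n) ((lam * h) ^+ 2)%:E)%E).
    by apply: lee_sum => i _; exact: probability_increment_ge2.
  rewrite sumEFin lee_fin big_const_seq count_predT size_iota iter_addr_0.
  by rewrite mulr_natl.
rewrite (le_trans (measure_bigsetU_le _ _ _))//.
  by move=> b; exact: measurable_increments_event.
(* All retained sequences have the same length and the same number of ones, hence the same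
   probability, so the sum is a count. *)
rewrite (_ : \sum_(b <- _ | _) _ = (expR (- (lam * t)) * lam ^+ k.+1)%:E *
    (h ^+ k.+1 * (count p (bitseqs n))%:R)%:E)%E; last first.
  rewrite -size_filter -EFinM -mulrA (mulrA (lam ^+ _)) -exprMn mulrA mulr_natr.
  rewrite -count_predT -iter_addr_0 -big_const_seq -sumEFin.
  rewrite big_seq [RHS]big_seq; apply: eq_bigr => b.
  rewrite mem_filter mem_bitseqs => /andP[/andP[/eqP kb _] /eqP sb].
  by rewrite -[LHS]/(P (increments_event h b)) probability_increments_event// sb kb -tE.
apply: lee_wpmul2l; first by rewrite lee_fin mulr_ge0 ?expR_ge0// exprn_ge0// ltW.
apply: count_bitseqs_le_integral => // i ni /asboolP[v Dv vi] w iw.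
apply: (DB v) => //.
have -> : v - w = (v - h * (i + ~~ odd k)%N%:R) + (h * (i + ~~ odd k)%N%:R - w) by ring.
rewrite (le_trans (ler_normD _ _))// -natr1 mulrDl mul1r.
rewrite (mulrC _ h) lerD// ler_norml natrD mulrDr (mulrC h i%:R).
move: iw; rewrite -natr1 mulrDl mul1r.
by case: odd => /=; rewrite ?mulr0 ?mulr1 => iw; apply/andP; split; lra.
Qed.

End increment_events.

Lemma lee_add_inv_nat (R : realType) (a b : \bar R) (C : R) : 0 <= C ->
  (forall n : nat, (a <= b + (C / n.+1%:R)%:E)%E) -> (a <= b)%E.
Proof.
move=> C0 H; apply/lee_addgt0Pr => e e0.
rewrite (le_trans (H (Num.truncn (C / e))))// leeD2l// lee_fin.
rewrite ler_pdivrMr// mulrC -ler_pdivrMr//.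
by rewrite ltW// truncnS_gt.
Qed.

(** * Limit of small steps *)

Section even_time_law.
Context (R : realType) (d : measure_display) (T : measurableType d).
Variables (P : probability T R) (lam : R) (N : R -> T -> nat).
Hypothesis lam_gt0 : 0 < lam.
Hypothesis N_poisson : poisson_process P lam N.
Local Notation lebesgue := (@lebesgue_measure R).
Variable t : R.
Hypothesis t_gt0 : 0 < t.
Let t_ge0 : 0 <= t := ltW t_gt0.

Let md k D : measurable_fun D (fun w => (occupation_density k t w)%:E).
Proof.
apply/measurable_EFinP; apply: measurable_funTS.
exact: measurable_occupation_density.
Qed.

Let d0 k w : (0 <= (occupation_density k t w)%:E)%E.
Proof. by rewrite lee_fin occupation_density_ge0. Qed.

Lemma measurable_jumps k : measurable [set w | N t w = k].
Proof.
rewrite -[X in measurable X]setTI.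
exact: (poisson_measurable N_poisson t_ge0 measurableT (Y := [set k])).
Qed.

Lemma measurable_even_time_preimage B : measurable B ->
  measurable (even_time N t @^-1` B).
Proof.
by move=> mB; rewrite -[X in measurable X]setTI; exact: (measurable_even_time N_poisson).
Qed.

Lemma probability_jumps k : P [set w | N t w = k] = (poisson_pmf (lam * t) k)%:E.
Proof.
have := poisson_increment N_poisson k (lexx 0) t_gt0; rewrite subr0 => <-.
congr (P _); apply/seteqP; split => w /=;
  by rewrite (poisson_start N_poisson) subn0.
Qed.

Lemma integral_occupation_density_itv_le k (u v : R) : u <= v ->
  (\int[lebesgue]_(w in `[u, v]) (occupation_density k t w)%:E <=
   (t ^+ k * (v - u))%:E)%E.
Proof.
move=> uv; have lE : (v - u)%:E = lebesgue `[u, v].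
  rewrite lebesgue_measure_itv/= lte_fin -EFinB; case: ltP => // vu.
  by congr EFin; lra.
have muv : measurable (`[u, v]%classic : set (measurableTypeR R)).
  exact: measurable_itv.
rewrite EFinM lE -integral_cst//; apply: ge0_le_integral => //.
- exact: md.
- by move=> w _; rewrite lee_fin occupation_density_le.
Qed.

(** The e-neighbourhood of [D] exceeds [D] by at most an interval of length e, of weight at most t^k
    e. With h = t / (n + 1), this and the probability of multiple jumps in a step are both
    O(1/n). *)
Lemma even_time_le_integral_limit k (D : set R) (E : R -> set R) :
  measurable D ->
  (forall e, 0 < e -> exists2 u, E e = `[u, (u + e)%R]%classic &
     forall v w, D v -> `|v - w| <= e -> D w \/ E e w) ->
  (P [set w | D (even_time N t w) /\ N t w = k.+1] <=
   (expR (- (lam * t)) * lam ^+ k.+1)%:E *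
     \int[lebesgue]_(w in D) (occupation_density k t w)%:E)%E.
Proof.
move=> mD ED.
set c := expR _ * _; have c0 : 0 <= c by rewrite mulr_ge0 ?expR_ge0// exprn_ge0// ltW.
(* The constant is n + 1 times the error (n + 1) (lam h)^2 + c t^k (k + 2) h. *)
apply: (@lee_add_inv_nat _ _ _ ((lam * t) ^+ 2 + c * (t ^+ k * (k.+2%:R * t)))).
  apply: addr_ge0; first exact: sqr_ge0.
  apply: mulr_ge0 => //; apply: mulr_ge0; first exact: exprn_ge0.
  exact: mulr_ge0.
move=> n; set h := t / n.+1%:R; have h0 : 0 < h by rewrite divr_gt0.
have th : t = n.+1%:R * h by rewrite /h mulrC divfK.
have e0 : 0 < k.+2%:R * h by rewrite mulr_gt0.
have [u EE DE] := ED _ e0.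
have mE : measurable (E (k.+2%:R * h)) by rewrite EE; exact: measurable_itv.
apply: (le_trans (even_time_le_integral lam_gt0 N_poisson h0 th mD
  (measurableU _ _ mD mE) DE)).
rewrite -/c; apply: (@le_trans _ _ ((n.+1%:R * (lam * h) ^+ 2)%:E +
  c%:E * (\int[lebesgue]_(w in D) (occupation_density k t w)%:E +
     (t ^+ k * (k.+2%:R * h))%:E))%E).
  rewrite leeD2l// lee_wpmul2l//.
  pose m : {measure set (measurableTypeR R) -> \bar R} :=
    density_measure lebesgue
      (measurable_occupation_density k t : measurable_fun [set: measurableTypeR R] _)
      (occupation_density_ge0 k t).
  apply: (le_trans (measureU2 m mD mE)); rewrite leeD2l// EE.
  have := @integral_occupation_density_itv_le k u (u + k.+2%:R * h).
  by rewrite lerDl (ltW e0) [u + _ - u]addrAC subrr add0r; apply.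
have Ifin : (\int[lebesgue]_(w in D) (occupation_density k t w)%:E)%E \is a fin_num.
  rewrite ge0_fin_numE; last by apply: integral_ge0 => w _.
  apply: (@le_lt_trans _ _ (\int[lebesgue]_w (occupation_density k t w)%:E)%E).
    by apply: ge0_subset_integral => //; exact: md.
  by rewrite integral_occupation_density// ltry.
rewrite -(fineK Ifin); move: (fine _) => I.
have -> : forall a b g : R, (a%:E + c%:E * (I%:E + b%:E) <= c%:E * I%:E + g%:E)%E = (a + c * (I + b) <= c * I + g) by [].
rewrite le_eqVlt; apply/orP; left; apply/eqP; rewrite /h; field.
by rewrite addrC natr1 pnatr_eq0.
Qed.

(* The upper bounds on complementary half-lines are equalities because the total
   masses agree. *)
Lemma even_time_law_succ k (B : set R) : measurable B ->
  P (even_time N t @^-1` B `&` [set w | N t w = k.+1]) =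
  ((expR (- (lam * t)) * lam ^+ k.+1)%:E *
     \int[lebesgue]_(w in B) (occupation_density k t w)%:E)%E.
Proof.
move=> mB.
have mJ := measurable_jumps k.+1.
have mE : measurable_fun [set: T] (even_time N t : T -> measurableTypeR R).
  exact: (measurable_even_time N_poisson).
pose c : R := expR (- (lam * t)) * lam ^+ k.+1.
have c0 : 0 <= c by rewrite mulr_ge0 ?expR_ge0// exprn_ge0// ltW.
pose dm : {measure set (measurableTypeR R) -> \bar R} :=
  density_measure lebesgue
    (measurable_occupation_density k t : measurable_fun [set: measurableTypeR R] _)
    (occupation_density_ge0 k t).
pose m2 : {measure set (measurableTypeR R) -> \bar R} := mscale (NngNum c0) dm.
pose m1 : {measure set (measurableTypeR R) -> \bar R} :=
  measure_function_pushforward__canonical__measure_function_Measure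
    (mrestr P mJ) mE.
suff : m1 B = m2 B by [].
have m1T : m1 setT = (poisson_pmf (lam * t) k.+1)%:E.
  by rewrite /m1/= /pushforward /mrestr preimage_setT setTI probability_jumps.
have m12T : m1 setT = m2 setT.
  rewrite m1T /m2/= /mscale/= /density_measure integral_occupation_density//.
  rewrite /poisson_pmf mulr_gt0// -EFinM; congr EFin.
  by rewrite /c exprMn; ring.
have m1E A : m1 A = P [set w | A (even_time N t w) /\ N t w = k.+1] by [].
have le1 (x : R) : (m1 `]-oo, x]%classic <= m2 `]-oo, x]%classic)%E.
  rewrite m1E; apply: (@even_time_le_integral_limit k _ (fun e => `[x, (x + e)%R]%classic)) => //.
  move=> e e0; exists x => // v w /=; rewrite !in_itv/= => vx.
  rewrite ler_distl => /andP[wv _]; case: (leP w x) => wx; [by left|right].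
  by apply/andP; split; lra.
have le2 (x : R) : (m1 `[x, +oo[%classic <= m2 `[x, +oo[%classic)%E.
  rewrite m1E; apply: (@even_time_le_integral_limit k _ (fun e => `[(x - e)%R, (x - e + e)%R]%classic)) => //.
  move=> e e0; exists (x - e) => // v w /=; rewrite !in_itv/= !andbT => xv.
  rewrite ler_distl => /andP[_ wv]; case: (leP x w) => wx; [by left|right].
  by apply/andP; split; lra.
apply: measure_eq_rays => // x; last first.
  apply: (@le_lt_trans _ _ (m1 setT)); last by rewrite m1T ltry.
  by apply: le_measure; rewrite ?inE.
have mray : measurable (`]x, +oo[%classic : set (measurableTypeR R)) by exact: measurable_itv.
have mrayC : measurable (`]-oo, x]%classic : set (measurableTypeR R)) by exact: measurable_itv.
have split_ray (m : {measure set (measurableTypeR R) -> \bar R}) :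
    m setT = (m `]-oo, x]%classic + m `]x, +oo[%classic)%E.
  rewrite -measureU//.
    by rewrite -setCitvl setUv.
  by rewrite -setCitvl setICr.
apply/eqP; rewrite eq_le; apply/andP; split.
  (* The bound on closed rays passes to open ones because [m2] has a density and does not charge the
     end point. *)
  apply: (@le_trans _ _ (m1 `[x, +oo[%classic)).
    apply: le_measure; first by rewrite inE.
      by rewrite inE; exact: measurable_itv.
    by move=> y /=; rewrite !in_itv/= !andbT; exact: ltW.
  rewrite (le_trans (le2 x))// /m2/= /mscale/= /density_measure.
  by rewrite integral_itv_obnd_cbnd//; exact: md.
have m2fin A : measurable A -> m2 A \is a fin_num.
  move=> mA; rewrite ge0_fin_numE//; apply: (@le_lt_trans _ _ (m2 setT)).
    by apply: le_measure; rewrite ?inE.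
  by rewrite -m12T m1T ltry.
(* The total masses agree and [m1] is at most [m2] on the left ray; cancelling the finite mass of
   the left ray gives the reverse inequality on the right one. *)
have := m12T; rewrite (split_ray m1) (split_ray m2) => E.
have : (m1 `]-oo, x]%classic + m2 `]x, +oo[%classic <= m1 `]-oo, x]%classic + m1 `]x, +oo[%classic)%E.
  by rewrite E leeD2r.
rewrite leeD2lE// ge0_fin_numE//.
by rewrite (le_lt_trans (le1 x))// -ge0_fin_numE// m2fin.
Qed.

Lemma even_time_no_jump w : N t w = 0%N -> even_time N t w = t.
Proof.
move=> Nw; rewrite /even_time /signed_time.
rewrite (@eq_Rintegral _ _ _ _ _ (fun=> 1)).
  rewrite Rintegral_cst// (congr1 fine (lebesgue_measure_itv `[0, t])) /=.
  by rewrite lte_fin t_gt0 -EFinB subr0/= mul1r; field.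
move=> s; rewrite inE/= in_itv/= => /andP[s0 st].
suff -> : N s w = 0%N by [].
by apply/eqP; rewrite -leqn0 -Nw; exact: (poisson_nondecreasing N_poisson).
Qed.

Lemma even_time_law_0 (B : set R) : measurable B ->
  P (even_time N t @^-1` B `&` [set w | N t w = 0%N]) =
  ((expR (- (lam * t)))%:E * \d_t B)%E.
Proof.
move=> mB; have [tB|tB] := boolP (t \in B).
  rewrite (_ : _ `&` _ = [set w | N t w = 0%N]); last first.
    apply/seteqP; split => w /=; first by case.
    by move=> Nw; rewrite /= even_time_no_jump//; split => //; rewrite inE in tB.
  rewrite probability_jumps diracE tB mule1 /poisson_pmf mulr_gt0//.
  by rewrite expr0 fact0 invr1 !mul1r.
rewrite (_ : _ `&` _ = set0) ?measure0; last first.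
  rewrite -subset0 => w [/= + Nw]; rewrite even_time_no_jump// => tB'.
  by move: tB; rewrite notin_setE.
by rewrite diracE (negbTE tB) mule0.
Qed.

End even_time_law.

(** * Law of the telegraph process *)

Section even_time_law_total.
Context (R : realType) (d : measure_display) (T : measurableType d).
Variables (P : probability T R) (lam : R) (N : R -> T -> nat).
Hypothesis lam_gt0 : 0 < lam.
Hypothesis N_poisson : poisson_process P lam N.
Local Notation lebesgue := (@lebesgue_measure R).

Lemma even_time_law t (B : set R) : 0 < t -> measurable B ->
  P (even_time N t @^-1` B) =
  ((expR (- (lam * t)))%:E * \d_t B +
   \sum_(k <oo) (expR (- (lam * t)) * lam ^+ k.+1)%:E *
     \int[lebesgue]_(w in B) (occupation_density k t w)%:E)%E.
Proof.
move=> t0 mB.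
have mE := measurable_even_time_preimage N_poisson t0 mB.
have mJ := measurable_jumps N_poisson t0.
have -> : even_time N t @^-1` B =
   (even_time N t @^-1` B `&` [set w | N t w = 0%N]) `|`
   \bigcup_k (even_time N t @^-1` B `&` [set w | N t w = k.+1]).
  apply/seteqP; split => [w Bw|w [[]//|[k _ []//]]].
  case Nw : (N t w) => [|k]; [by left|right].
  by exists k.
rewrite measureU; last 3 first.
- exact: measurableI.
- by apply: bigcupT_measurable => k; exact: measurableI.
- rewrite -subset0 => w [[_ /= N0] [k _ [_ /=]]].
  by rewrite N0.
congr (_ + _)%E; first exact: (even_time_law_0 lam_gt0 N_poisson).
pose F k := even_time N t @^-1` B `&` [set w | N t w = k.+1].
rewrite -[LHS]/((P : {measure set T -> \bar R}) (\bigcup_k F k)).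
rewrite measure_semi_bigcup//; last 3 first.
- by move=> k; exact: measurableI.
- apply/trivIsetP => i j _ _ ij; rewrite -subset0 => w [[_ /= Ni] [_ /= Nj]].
  by move: Ni; rewrite Nj => -[/eqP]; rewrite eq_sym (negbTE ij).
- by apply: bigcupT_measurable => k; exact: measurableI.
by apply: eq_eseriesr => k _; exact: (even_time_law_succ lam_gt0 N_poisson).
Qed.

End even_time_law_total.

(** * Bessel series of the density *)

Section telegraph_density.
Context (R : realType).
Variables (lam c t : R).
Hypotheses (lam_gt0 : 0 < lam) (c_gt0 : 0 < c) (t_gt0 : 0 < t).

Definition bessel_term (n : nat) (y : R) (k : nat) : R :=
  (y / 2) ^+ (n + 2 * k) / (k`!%:R * (k + n)`!%:R).

(** [besselI] is a [limn], meaningful only once convergence is known. The terms are dominated by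
    those of (y/2)^n exp((y/2)^2). *)
Lemma cvg_besselI n y : 0 <= y -> series (bessel_term n y) @ \oo --> besselI n y.
Proof.
move=> y0; suff : cvgn (series (bessel_term n y)) by [].
set z := y / 2.
have z0 : 0 <= z by rewrite divr_ge0.
apply: (@series_le_cvg _ _ (fun k => z ^+ n * exp_coeff (z ^+ 2) k)).
- by move=> k; rewrite /bessel_term divr_ge0 ?exprn_ge0// mulr_ge0.
- by move=> k; rewrite mulr_ge0 ?exprn_ge0// exp_coeff_ge0// sqr_ge0.
- move=> k; rewrite /bessel_term /exp_coeff/= -/z exprD exprM -mulrA.
  rewrite ler_wpM2l ?exprn_ge0// ler_wpM2l ?exprn_ge0 ?sqr_ge0//.
  rewrite invfM ler_piMr ?invr_ge0// invf_le1 ?ltr0n ?fact_gt0//.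
  by rewrite ler1n fact_gt0.
by rewrite -/(series _); apply: is_cvg_seriesZ; exact: is_cvg_series_exp_coeff.
Qed.

(** The contribution of k + 1 jumps to the density of X(t). Solving x = c (2w - t) and x = -c (2w -
    t) gives the two arguments; 1/(4c) is the Jacobian 1/(2c) times the probability 1/2 of each
    sign. *)
Definition telegraph_term (k : nat) (x : R) : R :=
  expR (- (lam * t)) * lam ^+ k.+1 / (4 * c) *
  (occupation_density k t ((t + x / c) / 2) +
   occupation_density k t ((t - x / c) / 2)).

Lemma telegraph_term_ge0 k x : 0 <= telegraph_term k x.
Proof.
rewrite /telegraph_term mulr_ge0 ?addr_ge0 ?occupation_density_ge0//.
by rewrite divr_ge0 ?mulr_ge0 ?expR_ge0// ?exprn_ge0// ltW.
Qed.

(** The two arguments u and v satisfy u + v = t and u v = (r/(2c))^2. For 2m + 1 jumps the sum is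
    symmetric, 2 (u v)^m; for 2m + 2 jumps it is (u v)^m (u + v), whence the factor t of the I_1
    part. *)
Lemma telegraph_term_pair m x : `|x| < c * t ->
  let r := Num.sqrt (c ^+ 2 * t ^+ 2 - x ^+ 2) in
  telegraph_term m.*2 x + telegraph_term m.*2.+1 x =
  lam * expR (- (lam * t)) / 2 *
    (c^-1 * bessel_term 0 (lam / c * r) m + t * (bessel_term 1 (lam / c * r) m / r)).
Proof.
move=> xct r.
have r2 : r ^+ 2 = c ^+ 2 * t ^+ 2 - x ^+ 2.
  by rewrite sqr_sqrtr// subr_ge0 -exprMn -real_normK ?num_real// lerXn2r// ?nnegrE ?mulr_ge0// ltW.
have r0 : 0 < r.
  by rewrite sqrtr_gt0 subr_gt0 -exprMn -real_normK ?num_real// ltrXn2r// ?nnegrE ?mulr_ge0// ltW.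
have /andP[xl xu] : - t < x / c < t.
  rewrite ltr_pdivlMr// ltr_pdivrMr// mulNr mulrC -ltr_norml; by [].
set u := (t + x / c) / 2; set v := (t - x / c) / 2.
have ut : 0 < u < t by apply/andP; split; rewrite /u; lra.
have vt : 0 < v < t by apply/andP; split; rewrite /v; lra.
have tu : t - u = v by rewrite /u /v; field; rewrite gt_eqF.
have tv : t - v = u by rewrite /u /v; field; rewrite gt_eqF.
have uv : u * v = (r / (2 * c)) ^+ 2.
  by rewrite exprMn r2 /u /v; field; rewrite gt_eqF.
have uvt : u + v = t by rewrite -tu addrC subrK.
rewrite /telegraph_term /occupation_density -/u -/v ut vt tu tv /=.
rewrite uphalf_double half_double.
have m0 : m`!%:R != 0 :> R by rewrite pnatr_eq0 -lt0n fact_gt0.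
have m1 : m.+1`!%:R != 0 :> R by rewrite pnatr_eq0 -lt0n fact_gt0.
have -> : u ^+ m * v ^+ m / (m`!%:R * m`!%:R) + v ^+ m * u ^+ m / (m`!%:R * m`!%:R) =
    2 * (r / (2 * c)) ^+ (2 * m) / (m`!%:R * m`!%:R).
  by rewrite exprM -uv (exprMn m u v); field.
have -> : u ^+ m.+1 * v ^+ m / (m.+1`!%:R * m`!%:R) +
          v ^+ m.+1 * u ^+ m / (m.+1`!%:R * m`!%:R) =
    t * (r / (2 * c)) ^+ (2 * m) / (m.+1`!%:R * m`!%:R).
  by rewrite exprM -uv (exprMn m u v) -uvt !exprS; field; rewrite m0 m1.
rewrite /bessel_term addn0 addn1 add0n add1n.
have -> : lam / c * r / 2 = lam * (r / (2 * c)) by field; rewrite gt_eqF.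
rewrite (exprD _ 1) expr1 !exprMn -!muln2 !(mulnC m) !exprS.
move: (r ^+ (2 * m)) (lam ^+ (2 * m)) (_^-1 ^+ (2 * m)) => q l j.
by field; rewrite !gt_eqF//= m0 m1.
Qed.

Lemma telegraph_term0 k x : c * t <= `|x| -> telegraph_term k x = 0.
Proof.
move=> ctx; rewrite /telegraph_term /occupation_density.
have H : 2 * c > 0 by rewrite mulr_gt0.
have [xl|xu] : x / c <= - t \/ t <= x / c.
  rewrite ler_pdivrMr// ler_pdivlMr// mulNr mulrC.
  by move: ctx; rewrite ler_normr => /orP[|]; [right|left]; lra.
- rewrite ifF; last by apply/negbTE/negP => /andP[]; lra.
  by rewrite ifF ?addr0 ?mulr0//; apply/negbTE/negP => /andP[]; lra.
- rewrite ifF; last by apply/negbTE/negP => /andP[]; lra.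
  by rewrite ifF ?addr0 ?mulr0//; apply/negbTE/negP => /andP[]; lra.
Qed.

Lemma nneseries_telegraph_term x :
  (\sum_(k <oo) (telegraph_term k x)%:E = (mu_ind lam c x t)%:E)%E.
Proof.
rewrite /mu_ind; have [xct|ctx] := ltP `|x| (c * t); last first.
  by apply: eseries0 => k _ _; rewrite telegraph_term0.
set r := Num.sqrt (c ^+ 2 * t ^+ 2 - x ^+ 2).
have y0 : 0 <= lam / c * r by rewrite mulr_ge0 ?sqrtr_ge0// divr_ge0// ltW.
pose S n := (\sum_(0 <= k < n) (telegraph_term k x)%:E)%E.
have Scvg : S @ \oo --> (\sum_(k <oo) (telegraph_term k x)%:E)%E.
  by apply: is_cvg_nneseries => k _ _; rewrite lee_fin telegraph_term_ge0.
(* Since the terms match Bessel terms in pairs, only the partial sums of even length are computed;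
   they have the same limit. *)
have S2cvg : (S \o double) @ \oo --> (\sum_(k <oo) (telegraph_term k x)%:E)%E.
  apply: cvg_comp Scvg => A [m _ mA]; exists m => // n /= mn; apply: mA => /=.
  by rewrite -addnn (leq_trans mn)// leq_addr.
apply: (cvg_unique _ S2cvg) => //.
have -> : S \o double = EFin \o (fun n => lam * expR (- (lam * t)) / 2 *
    (c^-1 * series (bessel_term 0 (lam / c * r)) n +
     t * (series (bessel_term 1 (lam / c * r)) n / r))).
  apply/funext => n /=; rewrite /S.
  elim: n => [|n ih].
    by rewrite /series/= !big_nil mul0r !mulr0 addr0 mulr0.
  rewrite doubleS !big_nat_recr//= ih -!EFinD; congr EFin.
  rewrite -addrA telegraph_term_pair// /series/= !big_nat_recr//= -/r.
  ring.
apply: cvg_EFin; first exact: nearW.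
apply: cvgM; first exact: cvg_cst.
apply: cvgD; (apply: cvgM; first exact: cvg_cst).
  exact: cvg_besselI.
by apply: cvgM; [exact: cvg_besselI|exact: cvg_cst].
Qed.

End telegraph_density.

Section mu_ind.
Context (R : realType).
Variables (lam c t : R).
Hypotheses (lam_gt0 : 0 < lam) (c_gt0 : 0 < c) (t_ge0 : 0 <= t).

Lemma mu_ind0 x : mu_ind lam c x 0 = 0.
Proof. by rewrite /mu_ind mulr0 normr_lt0. Qed.

Lemma measurable_telegraph_term k : measurable_fun [set: R] (telegraph_term lam c t k).
Proof.
apply: measurable_funM => //; apply: measurable_funD;
  apply: measurableT_comp; try exact: measurable_occupation_density.
- by apply: measurable_funM => //; apply: measurable_funD => //; exact: measurable_funM.
- by apply: measurable_funM => //; apply: measurable_funB => //; exact: measurable_funM.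
Qed.

(** Measurability is read off the series of [telegraph_term]. At t = 0 the indicator is never
    satisfied and the function is 0. *)
Lemma measurable_mu_ind : measurable_fun [set: R] (fun x => (mu_ind lam c x t)%:E).
Proof.
have [<-|t0] := eqVneq 0 t.
  by under eq_fun do rewrite mu_ind0; exact: measurable_cst.
have tp : 0 < t by rewrite lt0r eq_sym t0.
under eq_fun do rewrite -(nneseries_telegraph_term lam_gt0 c_gt0 tp).
apply: ge0_emeasurable_sum => [k x _ _|k _].
  by rewrite lee_fin telegraph_term_ge0.
by apply/measurable_EFinP; exact: measurable_telegraph_term.
Qed.

Lemma mu_ind_ge0 x : (0 <= (mu_ind lam c x t)%:E)%E.
Proof.
have [<-|t0] := eqVneq 0 t; first by rewrite mu_ind0.
have tp : 0 < t by rewrite lt0r eq_sym t0.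
rewrite -(nneseries_telegraph_term lam_gt0 c_gt0 tp).
by apply: nneseries_ge0 => k _ _; rewrite lee_fin telegraph_term_ge0.
Qed.

End mu_ind.

Section telegraph_law.
Context (R : realType) (d : measure_display) (T : measurableType d).
Variables (P : probability T R) (lam c : R) (N : R -> T -> nat) (V0 : T -> R).
Hypotheses (lam_gt0 : 0 < lam) (c_gt0 : 0 < c).
Hypothesis N_poisson : poisson_process P lam N.
Hypothesis V0_measurable : measurable_fun [set: T] V0.
Hypothesis V0_uniform : uniform_pm P V0 c.
Hypothesis V0_independent : independent_of_process P V0 N.
Local Notation lebesgue := (@lebesgue_measure R).
Implicit Types (t : R).

Lemma measurable_telegraph t : 0 <= t -> measurable_fun [set: T] (telegraph N V0 t).
Proof.
move=> t0.
have -> : telegraph N V0 t = (fun w => V0 w * (2 * even_time N t w - t)).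
  apply/funext => w; rewrite (telegraphE N_poisson) /even_time.
  by congr (_ * _); field.
apply: measurable_funM => //; apply: measurable_funB => //.
by apply: measurable_funM => //; exact: (measurable_even_time N_poisson).
Qed.

(** On {V(0) = v} one has X(t) = 2 v W - v t, and W is measurable for the sigma-algebra of N, so
    independence factors the probability. *)
Lemma probability_telegraph_given t (v : R) (A : set R) : 0 <= t -> measurable A ->
  P [set w | V0 w = v] = (2^-1)%:E ->
  P (telegraph N V0 t @^-1` A `&` [set w | V0 w = v]) =
  ((2^-1)%:E * P (even_time N t @^-1` [set w | A (2 * v * w + - (v * t))%R]))%E.
Proof.
move=> t0 mA Pv.
have mB : measurable [set w : R | A (2 * v * w + - (v * t))].
  have mf : measurable_fun setT (fun w : R => 2 * v * w + - (v * t)).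
    by apply: measurable_funD => //; exact: measurable_funM.
  by rewrite -[X in measurable X]setTI; exact: mf.
rewrite -Pv -(V0_independent (measurable_set1 v)
  (process_sigma_even_time N_poisson t0 mB)).
congr (P _); apply/seteqP; split => w /=; rewrite (telegraphE N_poisson) /even_time.
  by move=> [Aw <-]; split => //; move: Aw; congr (A _); field.
by move=> [-> Aw]; split => //; move: Aw; congr (A _); field.
Qed.

(** [uniform_pm] fixes two probabilities that add up to 1, so the event where V(0) is neither c nor
    -c is null. *)
Lemma probability_telegraph_split t (A : set R) : 0 <= t -> measurable A ->
  P (telegraph N V0 t @^-1` A) =
  (P (telegraph N V0 t @^-1` A `&` [set w | V0 w = c])
   + P (telegraph N V0 t @^-1` A `&` [set w | V0 w = (- c)%R]))%E.
Proof.
move=> t0 mA.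
have mV v : measurable [set w | V0 w = v].
  by rewrite -[X in measurable X]setTI; exact: (V0_measurable _ (measurable_set1 v)).
have mX : measurable (telegraph N V0 t @^-1` A).
  by rewrite -[X in measurable X]setTI; exact: measurable_telegraph.
have dis : [set w | V0 w = c] `&` [set w | V0 w = - c] = set0.
  by rewrite -subset0 => w [/= ->]; move: c_gt0; lra.
rewrite -measureU; last 3 first.
- exact: measurableI.
- exact: measurableI.
- by rewrite setIACA dis setI0.
rewrite -setIUr; set U := [set w | V0 w = c] `|` [set w | V0 w = - c].
have mU : measurable U by exact: measurableU.
have PU : P U = 1%E.
  rewrite measureU//; case: V0_uniform => PN Pc.
  by rewrite [X in (X + _)%E]Pc [X in (_ + X)%E]PN -EFinD; congr EFin; field.
rewrite [LHS](measureDI _ mX mU) [X in (X + _)%E](_ : _ = 0%E) ?add0e//.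
apply/eqP; rewrite eq_le measure_ge0 andbT.
rewrite -[leRHS](_ : P (~` U) = 0%E); last by rewrite probability_setC// PU subee.
have mD : measurable (telegraph N V0 t @^-1` A `\` U) by exact: measurableD.
have mUC : measurable (~` U) by exact: measurableC.
by apply: le_measure; rewrite ?inE// => w [].
Qed.

Lemma integral_occupation_affine k t (v : R) (A : set R) : v != 0 -> measurable A ->
  (\int[lebesgue]_(x in A) (occupation_density k t ((t + x / v) / 2))%:E =
   (2 * `|v|)%:E * \int[lebesgue]_(w in [set w | A (2 * v * w + - (v * t))%R])
      (occupation_density k t w)%:E)%E.
Proof.
move=> v0 mA.
rewrite (@integral_affine _ (2 * v) (- (v * t)))//; last 3 first.
- by rewrite mulf_neq0.
- apply/measurable_EFinP; apply: measurableT_comp; first exact: measurable_occupation_density.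
  by apply: measurable_funM => //; apply: measurable_funD => //; exact: measurable_funM.
- by move=> x; rewrite lee_fin occupation_density_ge0.
rewrite normrM ger0_norm//; congr (_ * _)%E; apply: eq_integral => w _.
by congr (occupation_density _ _ _)%:E; field.
Qed.

Lemma probability_telegraph_pos t (A : set R) : 0 < t -> measurable A ->
  P (telegraph N V0 t @^-1` A) = telegraph_law lam c t A.
Proof.
move=> t0 mA; have t0' := ltW t0; case: V0_uniform => PN Pc.
have cN0 : - c != 0 by rewrite oppr_eq0 gt_eqF.
have c0 : c != 0 by rewrite gt_eqF.
pose B v := [set w : R | A (2 * v * w + - (v * t))].
have mB v : measurable (B v).
  have mf : measurable_fun setT (fun w : R => 2 * v * w + - (v * t)).
    by apply: measurable_funD => //; exact: measurable_funM.
  by rewrite -[X in measurable X]setTI; exact: mf.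
rewrite probability_telegraph_split// !probability_telegraph_given//.
rewrite (even_time_law lam_gt0 N_poisson t0 (mB c)).
rewrite (even_time_law lam_gt0 N_poisson t0 (mB (- c))).
set e := expR _.
have dB v : \d_t (B v) = \d_(v * t) A :> \bar R.
  rewrite !diracE; congr ((nat_of_bool _)%:R%:E); apply/idP/idP; rewrite !inE /B/=;
    by congr (A _); ring.
rewrite !dB.
pose I k v := (\int[lebesgue]_(w in B v) (occupation_density k t w)%:E)%E.
have I0 k v : (0 <= I k v)%E.
  by apply: integral_ge0 => w _; rewrite lee_fin occupation_density_ge0.
have ek k : 0 <= e * lam ^+ k.+1 by rewrite mulr_ge0 ?expR_ge0// exprn_ge0// ltW.
pose S v := (\sum_(k <oo) (e * lam ^+ k.+1)%:E * I k v)%E.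
have S0 v : (0 <= S v)%E by apply: nneseries_ge0 => k _ _; rewrite mule_ge0// lee_fin.
rewrite -/(S c) -/(S (- c)) /telegraph_law -/e mulNr.
have -> : (\int[lebesgue]_(x in A) (mu_ind lam c x t)%:E = 2^-1%:E * (S c + S (- c)%R))%E.
  have mT k : measurable_fun A (fun x => (telegraph_term lam c t k x)%:E).
    apply/measurable_EFinP; apply: measurable_funTS.
    exact: measurable_telegraph_term.
  rewrite -nneseriesD; last 2 first.
  - by move=> k _ _; rewrite mule_ge0// lee_fin.
  - by move=> k _ _; rewrite mule_ge0// lee_fin.
  rewrite -nneseriesZl; last by move=> k _; rewrite adde_ge0// mule_ge0// lee_fin.
  under eq_integral do rewrite -(nneseries_telegraph_term lam_gt0 c_gt0 t0).
  rewrite integral_nneseries//; last first.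
    by move=> k x _; rewrite lee_fin telegraph_term_ge0.
  apply: eq_eseriesr => k _.
  have mO v : measurable_fun A (fun x => (occupation_density k t ((t + x / v) / 2))%:E).
    apply/measurable_EFinP; apply: measurable_funTS; apply: measurableT_comp.
      exact: measurable_occupation_density.
    by apply: measurable_funM => //; apply: measurable_funD => //; exact: measurable_funM.
  (* Writing t - x / c as t + x / (- c) treats both signs by the same affine change of variables,
     with Jacobian 2c; 2c / (4c) leaves the 1/2 of the uniform law. *)
  transitivity ((e * lam ^+ k.+1 / (4 * c))%:E *
      \int[lebesgue]_(x in A) ((occupation_density k t ((t + x / c) / 2))%:E +
        (occupation_density k t ((t + x / (- c)) / 2))%:E))%E.
    have mS : measurable_fun A (fun x =>
        (occupation_density k t ((t + x / c) / 2))%:E +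
        (occupation_density k t ((t + x / (- c)) / 2))%:E)%E.
      exact: emeasurable_funD.
    rewrite -ge0_integralZl//.
    - apply: eq_integral => x _; rewrite -EFinD -EFinM; congr EFin.
      by rewrite /telegraph_term invrN mulrN.
    - by move=> x _; rewrite -EFinD lee_fin addr_ge0// occupation_density_ge0.
    - by rewrite lee_fin divr_ge0// mulr_ge0// ltW.
  rewrite ge0_integralD//.
  - rewrite !integral_occupation_affine// normrN gtr0_norm// -/(I k c) -/(I k (- c)).
    rewrite -!ge0_muleDr// ?mule_ge0// muleA muleA -!EFinM; congr (_%:E * _)%E.
    by field; rewrite gt_eqF.
  - by move=> x _; rewrite lee_fin occupation_density_ge0.
  - exact: (mO c).
  - by move=> x _; rewrite lee_fin occupation_density_ge0.
  - exact: (mO (- c)).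
rewrite !ge0_muleDr ?mule_ge0 ?lee_fin ?expR_ge0//.
rewrite EFinM addeACA -!muleA; congr (_ + _)%E.
by rewrite addeC.
Qed.

(** At t = 0 the process is 0: the two half atoms coincide there and the density vanishes. *)
Lemma probability_telegraph t (A : set R) : 0 <= t -> measurable A ->
  P (telegraph N V0 t @^-1` A) = telegraph_law lam c t A.
Proof.
rewrite le_eqVlt => /predU1P[<-|] mA; last exact: probability_telegraph_pos.
have X0 w : telegraph N V0 0 w = 0 by rewrite /telegraph set_itv1 Rintegral_set1.
rewrite /telegraph_law !mulr0 oppr0 expR0 mulr1.
rewrite integral0_eq; last by move=> x _; rewrite mu_ind0.
rewrite adde0 diracE; have [A0|A0] := boolP (0 \in A).
  rewrite (_ : _ @^-1` _ = setT); last first.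
    by apply/seteqP; split => // w _ /=; rewrite X0; rewrite inE in A0.
  by rewrite probability_setT -EFinD -EFinM; congr EFin; rewrite /= -[1%:R]/(1 : R); field.
rewrite (_ : _ @^-1` _ = set0); last first.
  rewrite -subset0 => w /=; rewrite X0.
  by move: A0; rewrite notin_setE.
by rewrite measure0 adde0 mule0.
Qed.

End telegraph_law.

(** * Oscillators *)

Section arc_sum.
Context (R : realType).
Local Notation lebesgue := (@lebesgue_measure R).

Lemma measurable_on_unit_arc_sum (f : R -> \bar R) : measurable_fun [set: R] f ->
  (forall x, (0 <= f x)%E) ->
  measurable_fun [set: R] (on_unit (fun y => ((Num.sqrt (1 - y ^+ 2))^-1)%:E *
     \esum_(k in [set: int])
       (f ((2 * k%:~R + 2) * pi - acos y)%R + f (acos y + 2 * k%:~R * pi)%R))%E).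
Proof.
move=> mf f0.
pose s y := (\sum_(n <oo) (f ((2 * (int_of_nat_zigzag n)%:~R + 2) * pi - acos y)%R +
   f (acos y + 2 * (int_of_nat_zigzag n)%:~R * pi)%R))%E.
have -> : on_unit (fun y => ((Num.sqrt (1 - y ^+ 2))^-1)%:E *
     \esum_(k in [set: int])
       (f ((2 * k%:~R + 2) * pi - acos y)%R + f (acos y + 2 * k%:~R * pi)%R))%E =
  (fun y => ((Num.sqrt (1 - y ^+ 2))^-1)%:E * s y)%E \_ `](-1)%R, 1%R[.
  apply/funext => y; rewrite patchE /on_unit ltr_norml mem_setE in_itv/=.
  case: ifPn => // _; rewrite /s esum_int// => k; exact: adde_ge0.
apply/(measurable_restrictT _ (measurable_itv _)).
apply: emeasurable_funM.
  by apply/measurable_EFinP; exact: measurable_inv_sqrt.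
apply: ge0_emeasurable_sum => [n y _ _|n _]; first exact: adde_ge0.
apply: emeasurable_funD; (apply: (@measurableT_comp _ _ _ _ _ _ f) => //).
  by apply: measurable_funB => //; exact: measurable_acos.
by apply: measurable_funD => //; exact: measurable_acos.
Qed.

Lemma on_unit_arc_sum_ge0 (f : R -> \bar R) y : (forall x, (0 <= f x)%E) ->
  (0 <= on_unit (fun y => ((Num.sqrt (1 - y ^+ 2))^-1)%:E *
     \esum_(k in [set: int])
       (f ((2 * k%:~R + 2) * pi - acos y)%R + f (acos y + 2 * k%:~R * pi)%R)) y)%E.
Proof.
move=> f0; rewrite /on_unit; case: ifP => // _.
rewrite mule_ge0 ?inv_sqrt_ge0//; apply: esum_ge0 => k _; exact: adde_ge0.
Qed.

End arc_sum.

(** * Distribution functions over one period *)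

Section tiles.
Context (R : realType).
Implicit Types (a x : R).

(** Open on the left and closed on the right, like the intervals whose measure is a difference of
    two values of [F_X]. *)
Definition tile a (k : int) : set R :=
  `](a + 2 * k%:~R * pi), (a + 2 * k%:~R * pi + 2 * pi)]%classic.

Lemma esum_tile (m : {measure set (measurableTypeR R) -> \bar R}) (S : set R) a :
  measurable S -> m S = \esum_(k in [set: int]) m (S `&` tile a k).
Proof.
move=> mS; have pi0 := pi_gt0 R.
(* The floor is taken of a - x rather than x - a because the tiles contain their right end; this
   gives the index - k - 1. *)
have tileE k x : tile a k x = (Num.floor ((a - x) / (2 * pi)) == - k - 1) :> Prop.
  rewrite /tile/= in_itv/= floor_eq ler_pdivlMr ?mulr_gt0// ltr_pdivrMr ?mulr_gt0//.
  rewrite subrK !rmorphB/= !rmorphN/= mulrBl mul1r mulNr mulrA -(mulrC 2) (mulrAC 2).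
  congr is_true; rewrite andbC; congr (_ && _); apply/idP/idP; lra.
rewrite esum_int//.
have SE : S = \bigcup_n (S `&` tile a (int_of_nat_zigzag n)).
  rewrite -setI_bigcupr (_ : \bigcup_n _ = setT) ?setIT//.
  apply/seteqP; split => // x _; have [g _ gK] := int_of_nat_zigzag_bij.
  exists (g (- Num.floor ((a - x) / (2 * pi)) - 1)) => //=.
  by rewrite tileE gK; apply/eqP; lia.
rewrite {1}SE measure_semi_bigcup//.
- by move=> n; apply: measurableI => //; exact: measurable_itv.
- apply/trivIsetP => i j _ _ ij; rewrite -subset0 => x [[_ +] [_ +]].
  rewrite !tileE => /eqP -> /eqP kk; move/eqP: ij; apply.
  by apply: (bij_inj int_of_nat_zigzag_bij); lia.
by rewrite -SE.
Qed.

End tiles.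

Section cdf_difference.
Context (R : realType) (lam c t : R).
Variable m : {measure set (measurableTypeR R) -> \bar R}.
Hypothesis m_fin : (m setT < +oo)%E.
Hypothesis mE : forall A, measurable A -> m A = telegraph_law lam c t A.
Implicit Types (a b : R).

Let mfin A : measurable A -> m A \is a fin_num.
Proof.
move=> mA; rewrite ge0_fin_numE//; apply: le_lt_trans m_fin.
by apply: le_measure; rewrite ?inE.
Qed.

Lemma measure_itvoc_F a b : a <= b ->
  m `]a, b]%classic = (F_X lam c b t - F_X lam c a t)%:E.
Proof.
move=> ab; have mo x : measurable (`]-oo, x]%classic : set (measurableTypeR R)).
  exact: measurable_itv.
have mab : measurable (`]a, b]%classic : set (measurableTypeR R)).
  exact: measurable_itv.
rewrite /F_X -!mE; [|exact: mo|exact: mo].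
rewrite (_ : `]-oo, b]%classic = `]-oo, a]%classic `|` `]a, b]%classic); last first.
  apply/seteqP; split => x /=; rewrite !in_itv/=.
    by move=> xb; case: (leP x a) => xa; [left|right; rewrite xb].
  by move=> [|/andP[_ //]]; move=> /le_trans; apply.
rewrite measureU//; last first.
  by rewrite -subset0 => x [] /=; rewrite !in_itv/=; lra.
by rewrite fineD ?mfin// addrC addKr fineK ?mfin.
Qed.

Lemma measure_itvcc_F a b : a <= b ->
  m `[a, b]%classic = (F_X lam c b t - F_X_left lam c a t)%:E.
Proof.
move=> ab; have mo x : measurable (`]-oo, x]%classic : set (measurableTypeR R)).
  exact: measurable_itv.
have mo' x : measurable (`]-oo, x[%classic : set (measurableTypeR R)).
  exact: measurable_itv.
have mab : measurable (`[a, b]%classic : set (measurableTypeR R)).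
  exact: measurable_itv.
rewrite /F_X /F_X_left -!mE; [|exact: mo'|exact: mo].
rewrite (_ : `]-oo, b]%classic = `]-oo, a[%classic `|` `[a, b]%classic); last first.
  apply/seteqP; split => x /=; rewrite !in_itv/=.
    by move=> xb; case: (ltP x a) => xa; [left|right; rewrite xb].
  by move=> [xa|/andP[_ //]]; rewrite ltW// (lt_le_trans xa).
rewrite measureU//; last first.
  by rewrite -subset0 => x [] /=; rewrite !in_itv/=; lra.
by rewrite fineD ?mfin// addrC addKr fineK ?mfin.
Qed.

(** The jump of [F_X] at [a] is the mass of {a}, which is 0 away from the two atoms. *)
Lemma F_X_leftE a : a != c * t -> a != - (c * t) -> F_X_left lam c a t = F_X lam c a t.
Proof.
move=> a1 a2; have := measure_itvcc_F (lexx a).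
rewrite set_itv1 mE; last exact: measurable_set1.
rewrite /telegraph_law integral_set1 !diracE.
rewrite !memNset ?add0e ?mule0 ?adde0; last 2 first.
- by move=> /= E; rewrite E eqxx in a1.
- by move=> /= E; rewrite E eqxx in a2.
by move=> [] /esym/eqP; rewrite subr_eq0 => /eqP.
Qed.

End cdf_difference.

Section trigonometry.
Context (R : realType).
Implicit Types (x y s : R) (k : int).

Lemma asin_acos y : -1 <= y <= 1 -> asin y = pi / 2 - acos y.
Proof.
move=> y1; have := acos_ge0 y1; have := acos_lepi y1 => ap a0.
rewrite -[in LHS](acosK (x := y)) ?in_itv// -cosN -sinDpihalf addrC.
by rewrite sinK// in_itv/=; lra.
Qed.

Lemma sin_add_period k x : sin (x + 2 * k%:~R * pi) = sin x.
Proof. by rewrite -!cosBpihalf addrAC cos_add_period. Qed.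

(** The cosine decreases on [0, pi], and the second half period is reflected onto the first. *)
Lemma cos_le_period x s : -1 <= x <= 1 -> 0 <= s <= 2 * pi ->
  (cos s <= x) = (acos x <= s <= 2 * pi - acos x).
Proof.
move=> x1 /andP[s0 s2]; have a0 := acos_ge0 x1; have api := acos_lepi x1.
have H u : 0 <= u <= pi -> (cos u <= x) = (acos x <= u).
  move=> u0pi; rewrite -{1}(acosK (x := x)) ?in_itv//.
  by rewrite !leNgt ltr_cos// in_itv/= ?a0.
have [spi|pis] := leP s pi.
  rewrite H ?s0//; apply/idP/andP => [->|[]//]; split => //; lra.
have -> : cos s = cos (2 * pi - s).
  by rewrite cosB mulr_natl cos2pi sin2pi mul1r mul0r addr0.
rewrite H; last by lra.
by apply/idP/andP => [|[]]; [split; lra|lra].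
Qed.

Lemma sin_le_period x s : -1 <= x <= 1 -> - (pi / 2) <= s <= 3 / 2 * pi ->
  (sin s <= x) = (s <= asin x) || (pi - asin x <= s).
Proof.
move=> x1 /andP[s0 s2]; have a0 := asin_geNpi2 x1; have api := asin_lepi2 x1.
have H u : - (pi / 2) <= u <= pi / 2 -> (sin u <= x) = (u <= asin x).
  move=> u0pi; rewrite -{1}(asinK (x := x)) ?in_itv//.
  by rewrite !leNgt ltr_sin// in_itv/= ?a0.
have [spi|pis] := leP s (pi / 2).
  rewrite H ?s0//; apply/idP/orP => [->|[//|]]; [by left|lra].
have -> : sin s = sin (pi - s).
  by rewrite sinB sinpi cospi mul0r sub0r mulN1r opprK.
rewrite H; last by lra.
by apply/idP/orP => [|[]]; [right; lra|lra|lra].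
Qed.

(** As x < 1, acos x > 0 and the closed interval avoids the excluded left end of the tile. Its
    closed left end is the source of the left limit of [F_X]. *)
Lemma cos_le_tile x k : -1 <= x < 1 ->
  [set s : R | cos s <= x] `&` tile 0 k =
  `[(acos x + 2 * k%:~R * pi), ((2 * k%:~R + 2) * pi - acos x)]%classic.
Proof.
move=> /andP[x1 x2]; have a0 : 0 < acos x by rewrite acos_gt0// x1.
have x11 : -1 <= x <= 1 by rewrite x1 ltW.
have api := acos_lepi x11.
have cE s : cos s = cos (s - 2 * k%:~R * pi).
  by rewrite -(cos_add_period k (s - _)) subrK.
have pi0 := pi_gt0 R.
apply/seteqP; split => s; rewrite /tile/= !in_itv/=.
  move=> [+ sk]; rewrite cE cos_le_period//; lra.
move=> sk; split; last lra.
by rewrite cE cos_le_period//; lra.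
Qed.

(** The tile starts at a minimum of the sine, so the sublevel set has two pieces, next to the two
    ends. Only the second has a closed left end, hence a left limit of [F_X]. *)
Lemma sin_le_tile x k : -1 <= x <= 1 ->
  [set s : R | sin s <= x] `&` tile (- (pi / 2)) k =
  `]((2 * k%:~R - 2^-1) * pi), (asin x + 2 * k%:~R * pi)]%classic `|`
  `[((2 * k%:~R + 1) * pi - asin x), ((2 * k%:~R + 3 / 2) * pi)]%classic.
Proof.
move=> x1; have a0 := asin_geNpi2 x1; have api := asin_lepi2 x1.
have sE s : sin s = sin (s - 2 * k%:~R * pi).
  by rewrite -(sin_add_period k (s - _)) subrK.
have pi0 := pi_gt0 R.
apply/seteqP; split => s; rewrite /tile/= !in_itv/=.
  move=> [+ sk]; rewrite sE sin_le_period//; last lra.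
  by move=> /orP[?|?]; [left|right]; lra.
move=> sk; split; last by case: sk; lra.
rewrite sE sin_le_period//; last by case: sk; lra.
by apply/orP; case: sk => sk; [left|right]; lra.
Qed.

End trigonometry.

(** * Integrals over preimages under the sine *)

Section sin_preimage.
Context (R : realType).
Local Notation lebesgue := (@lebesgue_measure R).
Implicit Types (y : R) (f : R -> \bar R).

(** By asin y = pi/2 - acos y, the second families agree term by term and the first ones after
    replacing k by k + 1; the sums are split to allow this separate reindexing. *)
Lemma sin_arc_sumE f : (forall x, (0 <= f x)%E) ->
  on_unit (fun y => ((Num.sqrt (1 - y ^+ 2))^-1)%:E *
     \esum_(k in [set: int])
       (f (asin y + 2 * k%:~R * pi)%R + f ((2 * k%:~R + 1) * pi - asin y)%R))%E =
  on_unit (fun y => ((Num.sqrt (1 - y ^+ 2))^-1)%:E *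
     \esum_(k in [set: int])
       (f ((2 * k%:~R + 2) * pi - acos y + pi / 2)%R +
        f (acos y + 2 * k%:~R * pi + pi / 2)%R))%E.
Proof.
move=> f0; apply/funext => y; rewrite /on_unit; case: ifPn => // y1.
have {y1} y1 : -1 <= y <= 1 by move: y1; rewrite ltr_norml; lra.
congr (_ * _)%E; rewrite esumD; [|by []|by []].
rewrite [RHS]esumD; [|by []|by []].
rewrite asin_acos//; congr (_ + _)%E; last first.
  by apply: eq_esum => k _; congr f; field.
rewrite (@reindex_esum _ _ _ [set: int] [set: int] (fun k => k + 1)).
  by apply: eq_esum => k _; congr f; rewrite intrD; field.
rewrite setTT_bijective; exists (fun k => k - 1) => k; [exact: addrK|exact: subrK].
Qed.

Lemma ge0_integral_sin_preimage (A : set R) f : measurable A ->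
  measurable_fun [set: R] f -> (forall x, (0 <= f x)%E) ->
  (\int[lebesgue]_(x in sin @^-1` A) f x =
   \int[lebesgue]_(y in A) on_unit (fun y => ((Num.sqrt (1 - y ^+ 2))^-1)%:E *
     \esum_(k in [set: int])
       (f (asin y + 2 * k%:~R * pi)%R + f ((2 * k%:~R + 1) * pi - asin y)%R)) y)%E.
Proof.
move=> mA mf f0.
have ms : measurable (sin @^-1` A).
  by rewrite -[X in measurable X]setTI; exact: measurable_sin.
rewrite (@integral_affine _ 1 (pi / 2))// normr1 mul1e sin_arc_sumE//.
rewrite (_ : (fun x : R => 1 * x + pi / 2) @^-1` (sin @^-1` A) = cos @^-1` A); last first.
  by apply/seteqP; split => x; rewrite /preimage/= mul1r sinDpihalf.
transitivity (\int[lebesgue]_(x in cos @^-1` A) f (x + pi / 2)%R)%E.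
  by apply: eq_integral => x _; rewrite mul1r.
rewrite (@ge0_integral_cos_preimage _ A (fun x => f (x + pi / 2)))//.
by apply: measurableT_comp => //; exact: measurable_funD.
Qed.

End sin_preimage.

Lemma dirac_preimage (R : realType) (f : R -> R) (a : R) (A : set R) :
  \d_a (f @^-1` A) = \d_(f a) A :> \bar R.
Proof. by rewrite !diracE; congr ((nat_of_bool _)%:R%:E); apply/idP/idP; rewrite !inE. Qed.

(** The singular part consists of the two atoms, carried by the null set {a, b}. One weight is 0 for
    the cosine. *)
Lemma ac_density_dirac_sum (R : realType) (p q : R) (a b : R)
    (m : set R -> \bar R) (f : R -> \bar R) : 0 <= p -> 0 <= q ->
  measurable_fun [set: R] f -> (forall x, (0 <= f x)%E) ->
  (forall A, measurable A -> m A =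
    (p%:E * \d_a A + q%:E * \d_b A + \int[lebesgue_measure]_(x in A) f x)%E) ->
  ac_density m f.
Proof.
move=> p0 q0 mf f0 mE; split => //.
pose s : {measure set R -> \bar R} :=
  measure_add (mscale (NngNum p0) \d_a) (mscale (NngNum q0) \d_b).
have sE A : s A = (p%:E * \d_a A + q%:E * \d_b A)%E by exact: measure_addE.
exists s; split.
  exists [set a; b]; split.
  - by apply: measurableU; exact: measurable_set1.
  - apply/eqP; rewrite eq_le measure_ge0 andbT.
    rewrite (le_trans (measureU2 _ _ _))//; [exact: measurable_set1..|].
    rewrite [leLHS](_ : _ = 0%E)// -[RHS]adde0.
    by congr (_ + _)%E; exact: lebesgue_measure_set1.
  - rewrite sE !diracE !memNset ?mule0 ?adde0//=.
      by move=> H; apply: H; right.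
    by move=> H; apply: H; left.
by move=> A mA; rewrite mE// sE.
Qed.

(** * Laws and distribution functions of the oscillators *)

Section oscillators.
Context (R : realType) (d : measure_display) (T : measurableType d).
Variables (P : probability T R) (lam c : R) (N : R -> T -> nat) (V0 : T -> R).
Hypotheses (lam_gt0 : 0 < lam) (c_gt0 : 0 < c).
Hypothesis N_poisson : poisson_process P lam N.
Hypothesis V0_measurable : measurable_fun [set: T] V0.
Hypothesis V0_uniform : uniform_pm P V0 c.
Hypothesis V0_independent : independent_of_process P V0 N.
Variable t : R.
Hypothesis t_ge0 : 0 <= t.
Local Notation lebesgue := (@lebesgue_measure R).

Let mX : measurable_fun [set: T] (telegraph N V0 t : T -> measurableTypeR R) :=
  measurable_telegraph N_poisson V0_measurable t_ge0.

Let pX : {measure set (measurableTypeR R) -> \bar R} :=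
  measure_function_pushforward__canonical__measure_function_Measure P mX.

Let pXE A : measurable A -> pX A = telegraph_law lam c t A.
Proof. exact: probability_telegraph. Qed.

Let pX_fin : (pX setT < +oo)%E.
Proof. by rewrite /pX/= /pushforward preimage_setT probability_setT ltry. Qed.

Let mf := measurable_mu_ind lam_gt0 c_gt0 t_ge0.
Let f0 := mu_ind_ge0 lam_gt0 c_gt0 t_ge0.

Lemma measurable_Z1 : measurable_fun [set: T] (Z1 N V0 t).
Proof. by apply: measurableT_comp mX; exact: measurable_cos. Qed.

Lemma measurable_Z2 : measurable_fun [set: T] (Z2 N V0 t).
Proof. by apply: measurableT_comp mX; exact: measurable_sin. Qed.

(** Since the cosine is even, the two half atoms of X(t) fall on the same point. *)
Lemma law_Z1 A : measurable A ->
  law P (Z1 N V0 t) A =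
  ((expR (- (lam * t)))%:E * \d_(cos (c * t)) A +
   \int[lebesgue]_(x in A) on_unit (fun x => nu lam c x t) x)%E.
Proof.
move=> mA; rewrite -[LHS]/(pX (cos @^-1` A)) pXE; last exact: measurable_cos_preimage.
rewrite /telegraph_law !dirac_preimage cosN (ge0_integral_cos_preimage mA mf f0).
congr (_ + _)%E; rewrite diracE -EFinD -!EFinM; congr EFin.
by field.
Qed.

Lemma law_Z2 A : measurable A ->
  law P (Z2 N V0 t) A =
  ((2^-1 * expR (- (lam * t)))%:E * (\d_(sin (c * t))%R A + \d_(- sin (c * t))%R A)
   + \int[lebesgue]_(x in A) on_unit (fun x => eta lam c x t) x)%E.
Proof.
move=> mA; rewrite -[LHS]/(pX (sin @^-1` A)) pXE; last first.
  by rewrite -[X in measurable X]setTI; exact: measurable_sin.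
by rewrite /telegraph_law !dirac_preimage sinN addeC
  (ge0_integral_sin_preimage mA mf f0) addeC [(\d_ _ _ + _)%E]addeC.
Qed.

Lemma ac_density_Z1 : ac_density (law P (Z1 N V0 t)) (on_unit (fun x => nu lam c x t)).
Proof.
apply: (@ac_density_dirac_sum _ (expR (- (lam * t))) 0 (cos (c * t)) 0) => //.
- exact: (measurable_on_unit_arc_sum mf f0).
- by move=> x; exact: (on_unit_arc_sum_ge0 x f0).
- by move=> A mA; rewrite law_Z1// mul0e adde0.
Qed.

Lemma ac_density_Z2 : ac_density (law P (Z2 N V0 t)) (on_unit (fun x => eta lam c x t)).
Proof.
have e0 : 0 <= 2^-1 * expR (- (lam * t)) by rewrite mulr_ge0 ?expR_ge0.
have mf' : measurable_fun [set: R] (fun x => (mu_ind lam c (x + pi / 2) t)%:E).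
  by apply: (measurableT_comp mf); exact: measurable_funD.
have f0' x : (0 <= (mu_ind lam c (x + pi / 2) t)%:E)%E by exact: f0.
have etaE : on_unit (fun x => eta lam c x t) = _ := sin_arc_sumE f0.
apply: (ac_density_dirac_sum (a := sin (c * t)) (b := - sin (c * t)) e0 e0).
- by rewrite etaE; exact: (measurable_on_unit_arc_sum mf' f0').
- by move=> x; rewrite etaE; exact: (on_unit_arc_sum_ge0 x f0').
- by move=> A mA; rewrite law_Z2// ge0_muleDr.
Qed.

Lemma cdf_Z1_left x : -1 <= x < 1 ->
  P [set w | Z1 N V0 t w <= x] =
  zsum (fun k => F_X lam c ((2 * k%:~R + 2) * pi - acos x) t
                 - F_X_left lam c (acos x + 2 * k%:~R * pi) t).
Proof.
move=> x1; rewrite -[LHS]/(pX [set s | cos s <= x]).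
have mS : measurable [set s : R | cos s <= x].
  rewrite (_ : mkset _ = cos @^-1` `]-oo, x]); first exact: measurable_cos_preimage.
  by apply/seteqP; split => s; rewrite /= in_itv.
rewrite (esum_tile pX 0 mS); apply: eq_esum => k _.
rewrite cos_le_tile// (measure_itvcc_F pX_fin pXE)//.
have x11 : -1 <= x <= 1 by case/andP: x1 => -> /ltW.
by have := acos_lepi x11; lra.
Qed.

Lemma cdf_Z1 x : -1 <= x <= 1 -> ~ (x < 1 /\ x = cos (c * t)) ->
  P [set w | Z1 N V0 t w <= x] =
  zsum (fun k => F_X lam c ((2 * k%:~R + 2) * pi - acos x) t
                 - F_X lam c (acos x + 2 * k%:~R * pi) t).
Proof.
move=> x1 xct; have pi0 := pi_gt0 R.
have [xlt1|x1'] := ltP x 1.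
  have x11 : -1 <= x < 1 by case/andP: x1 => ->.
  rewrite cdf_Z1_left//; apply: eq_esum => k _; rewrite (F_X_leftE pX_fin pXE)//.
    (* An atom at a left end acos x + 2k pi would make x the cosine of ct, which is excluded. *)
    apply/eqP => E; apply: xct; split => //.
    by rewrite -E cos_add_period acosK ?in_itv.
  apply/eqP => E; apply: xct; split => //.
  by rewrite -cosN -E cos_add_period acosK ?in_itv.
(* At x = 1 the intervals are whole tiles, open on the left, so the plain values of [F_X] are exact
   even when an atom sits at an end. *)
have -> : x = 1 by lra.
rewrite -[LHS]/(pX [set s | cos s <= 1]).
rewrite (_ : mkset _ = setT); last first.
  by apply/seteqP; split => // s _ /=; exact: cos_le1.
rewrite (esum_tile pX 0 measurableT); apply: eq_esum => k _.
rewrite setTI /tile acos1 (measure_itvoc_F pX_fin pXE); last lra.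
by congr (F_X lam c _ t - F_X lam c _ t)%:E; ring.
Qed.

Lemma cdf_Z2_left x : -1 <= x < 1 ->
  P [set w | Z2 N V0 t w <= x] =
  zsum (fun k => F_X lam c (asin x + 2 * k%:~R * pi) t
                 - F_X lam c ((2 * k%:~R - 2^-1) * pi) t
                 + F_X lam c ((2 * k%:~R + 3 / 2) * pi) t
                 - F_X_left lam c ((2 * k%:~R + 1) * pi - asin x) t).
Proof.
move=> x1; rewrite -[LHS]/(pX [set s | sin s <= x]).
have x11 : -1 <= x <= 1 by case/andP: x1 => -> /ltW.
have ap := asin_ltpi2 x1; have an := asin_geNpi2 x11.
have mS : measurable [set s : R | sin s <= x].
  rewrite (_ : mkset _ = sin @^-1` `]-oo, x]).
    by rewrite -[X in measurable X]setTI; exact: measurable_sin.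
  by apply/seteqP; split => s; rewrite /= in_itv.
rewrite (esum_tile pX (- (pi / 2)) mS); apply: eq_esum => k _.
rewrite sin_le_tile// measureU; last 3 first.
- exact: measurable_itv.
- exact: measurable_itv.
- by rewrite -subset0 => s [] /=; rewrite !in_itv/=; lra.
rewrite -addrA EFinD; congr (_ + _)%E.
  by apply: (measure_itvoc_F pX_fin pXE); lra.
by apply: (measure_itvcc_F pX_fin pXE); lra.
Qed.

Lemma cdf_Z2 x : -1 <= x <= 1 ->
  ~ [/\ x < 1, x = sin (c * t) \/ x = - sin (c * t) & cos (c * t) <= 0] ->
  P [set w | Z2 N V0 t w <= x] =
  zsum (fun k => F_X lam c (asin x + 2 * k%:~R * pi) t
                 - F_X lam c ((2 * k%:~R - 2^-1) * pi) t
                 + F_X lam c ((2 * k%:~R + 3 / 2) * pi) t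
                 - F_X lam c ((2 * k%:~R + 1) * pi - asin x) t).
Proof.
move=> x1 xct; have pi0 := pi_gt0 R.
have [xlt1|x1'] := ltP x 1.
  have x11 : -1 <= x < 1 by case/andP: x1 => ->.
  have E k : (2 * k%:~R + 1) * pi - asin x = (pi - asin x) + 2 * k%:~R * pi by ring.
  have sE k : sin ((2 * k%:~R + 1) * pi - asin x) = x.
    rewrite E sin_add_period sinB sinpi cospi mul0r sub0r mulN1r opprK.
    by rewrite asinK ?in_itv.
  (* At these left ends the cosine is -sqrt(1 - x^2), so an atom there forces cos ct <= 0. *)
  have cE k : cos ((2 * k%:~R + 1) * pi - asin x) <= 0.
    rewrite E cos_add_period cosB sinpi cospi mul0r addr0 mulN1r oppr_le0.
    by rewrite cos_asin// sqrtr_ge0.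
  rewrite cdf_Z2_left//; apply: eq_esum => k _; rewrite (F_X_leftE pX_fin pXE)//.
    by apply/eqP => H; apply: xct; rewrite -H sE; split => //; left.
  apply/eqP => H; apply: xct; split => //.
    by right; rewrite -sinN -H sE.
  by rewrite -cosN -H cE.
have -> : x = 1 by lra.
have as1 : asin 1 = pi / 2 :> R by rewrite asin_acos ?acos1 ?subr0; lra.
rewrite -[LHS]/(pX [set s | sin s <= 1]).
rewrite (_ : mkset _ = setT); last first.
  by apply/seteqP; split => // s _ /=; exact: sin_le1.
rewrite (esum_tile pX (- (pi / 2)) measurableT); apply: eq_esum => k _.
rewrite setTI /tile as1 (measure_itvoc_F pX_fin pXE); last lra.
congr (_%:E).
(* At x = 1 the two pieces meet at the maximum of the sine, so their values of [F_X] cancel and the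
   ends of the tile remain. *)
have -> : (2 * k%:~R + 1) * pi - pi / 2 = pi / 2 + 2 * k%:~R * pi :> R by field.
rewrite [RHS](_ : _ = F_X lam c ((2 * k%:~R + 3 / 2) * pi) t -
  F_X lam c ((2 * k%:~R - 2^-1) * pi) t); last by ring.
by congr (F_X lam c _ t - F_X lam c _ t); field.
Qed.

End oscillators.

(* X(t) has atoms -ct and ct. With F_X right-continuous, the difference of
   values of F_X over an interval loses an atom sitting at its left end. Hence the
   series of values of F_X is the cdf except exactly when
   - for cos: x < 1 and x = cos ct, an atom being some acos x + 2k pi;
   - for sin: x < 1, x = +-sin ct and cos ct <= 0, an atom being some
     (2k+1) pi - asin x.
   The left limit F_X(y-, t) at these points repairs the formula for all x < 1,
   but may count an atom twice at x = 1, where the intervals share end points. *)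
Theorem theorem7 (R : realType) (d : measure_display) (T : measurableType d)
    (P : probability T R) (lam c : R) (N : R -> T -> nat) (V0 : T -> R)
    (lam_gt0 : 0 < lam) (c_gt0 : 0 < c)
    (N_poisson : poisson_process P lam N)
    (V0_measurable : measurable_fun [set: T] V0)
    (V0_uniform : uniform_pm P V0 c)
    (V0_independent : independent_of_process P V0 N)
    (t : R) (t_ge0 : 0 <= t) :
  [/\ measurable_fun [set: T] (Z1 N V0 t),
      forall x : R, -1 <= x <= 1 -> ~ (x < 1 /\ x = cos (c * t)) ->
        P [set w | Z1 N V0 t w <= x]
        = zsum (fun k => F_X lam c ((2 * k%:~R + 2) * pi - acos x) t
                         - F_X lam c (acos x + 2 * k%:~R * pi) t),
      forall x : R, -1 <= x < 1 ->
        P [set w | Z1 N V0 t w <= x]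
        = zsum (fun k => F_X lam c ((2 * k%:~R + 2) * pi - acos x) t
                         - F_X_left lam c (acos x + 2 * k%:~R * pi) t),
      forall A : set R, measurable A ->
        law P (Z1 N V0 t) A
        = ((expR (- (lam * t)))%:E * \d_(cos (c * t))%R A
           + \int[lebesgue_measure]_(x in A)
               on_unit (fun x => nu lam c x t) x)%E
    & ac_density (law P (Z1 N V0 t)) (on_unit (fun x => nu lam c x t))]
  /\
  [/\ measurable_fun [set: T] (Z2 N V0 t),
      forall x : R, -1 <= x <= 1 ->
        ~ [/\ x < 1, x = sin (c * t) \/ x = - sin (c * t) & cos (c * t) <= 0] ->
        P [set w | Z2 N V0 t w <= x]
        = zsum (fun k => F_X lam c (asin x + 2 * k%:~R * pi) t
                         - F_X lam c ((2 * k%:~R - 2^-1) * pi) t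
                         + F_X lam c ((2 * k%:~R + 3 / 2) * pi) t
                         - F_X lam c ((2 * k%:~R + 1) * pi - asin x) t),
      forall x : R, -1 <= x < 1 ->
        P [set w | Z2 N V0 t w <= x]
        = zsum (fun k => F_X lam c (asin x + 2 * k%:~R * pi) t
                         - F_X lam c ((2 * k%:~R - 2^-1) * pi) t
                         + F_X lam c ((2 * k%:~R + 3 / 2) * pi) t
                         - F_X_left lam c ((2 * k%:~R + 1) * pi - asin x) t),
      forall A : set R, measurable A ->
        law P (Z2 N V0 t) A
        = ((2^-1 * expR (- (lam * t)))%:E
             * (\d_(sin (c * t))%R A + \d_(- sin (c * t))%R A)
           + \int[lebesgue_measure]_(x in A)
               on_unit (fun x => eta lam c x t) x)%E
    & ac_density (law P (Z2 N V0 t)) (on_unit (fun x => eta lam c x t))].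
Proof.
split; split.
- exact: (measurable_Z1 N_poisson V0_measurable t_ge0).
- exact: (cdf_Z1 lam_gt0 c_gt0 N_poisson V0_measurable V0_uniform V0_independent t_ge0).
- exact: (cdf_Z1_left lam_gt0 c_gt0 N_poisson V0_measurable V0_uniform V0_independent t_ge0).
- exact: (law_Z1 lam_gt0 c_gt0 N_poisson V0_measurable V0_uniform V0_independent t_ge0).
- exact: (ac_density_Z1 lam_gt0 c_gt0 N_poisson V0_measurable V0_uniform V0_independent t_ge0).
- exact: (measurable_Z2 N_poisson V0_measurable t_ge0).
- exact: (cdf_Z2 lam_gt0 c_gt0 N_poisson V0_measurable V0_uniform V0_independent t_ge0).
- exact: (cdf_Z2_left lam_gt0 c_gt0 N_poisson V0_measurable V0_uniform V0_independent t_ge0).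
- exact: (law_Z2 lam_gt0 c_gt0 N_poisson V0_measurable V0_uniform V0_independent t_ge0).
- exact: (ac_density_Z2 lam_gt0 c_gt0 N_poisson V0_measurable V0_uniform V0_independent t_ge0).
Qed.
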